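(* Let $(M,\tau,\ell,\mathfrak m)$ be a metric measure spacetime and let $f:M\to\bar{\mathbb R}$ be causal. Then there exists a Borel function $G:M\to[0,+\infty]$ which is a weak subslope of $f$ and is $\mathfrak m$-a.e. no smaller than any other weak subslope of $f$. In particular, $G$ is unique up to modifications on $\mathfrak m$-negligible sets.
   Context: Conventions in $\bar{\mathbb R}=[-\infty,+\infty]$: $+\infty-(+\infty)=+\infty$, $-\infty-(-\infty)=+\infty$, $\pm\infty+z=\pm\infty$ for every $z\in\bar{\mathbb R}$, $0\cdot(\pm\infty)=0$. A time separation on a set $M$ is a map $\ell:M\times M\to\{-\infty\}\cup[0,+\infty]$ with $\ell(x,x)=0$ and $\min\{\ell(x,y)+\ell(y,z),\ell(y,z)+\ell(x,y)\}\le\ell(x,z)$; write $x\le y$ if $\ell(x,y)\ge0$. A metric measure spacetime $(M,\tau,\ell,\mathfrak m)$: $\tau$ is a Polish topology, $\ell$ a time separation with $\le$ a partial order and $\{\ell\ge0\}$ closed in $M^2$, $\mathfrak m$ a non-zero non-negative Radon measure. $\gamma:[0,1]\to M$ is causal if $s\le t$ implies $\gamma_s\le\gamma_t$. Its causal speed $|\dot\gamma_t|\in[0,+\infty]$ is the density of the absolutely continuous part (w.r.t. Lebesgue measure) of the largest Borel measure $\nu$ on $[0,1]$ with $\nu((a,b))\le\ell(\gamma_a,\gamma_b)$ for all $0\le a<b\le1$; for a.e. $t$ it equals $\lim_{h\downarrow0}\ell(\gamma_t,\gamma_{t+h})/h$. $\mathrm{LCC}([0,1];M)$ is the set of left-continuous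 causal curves with the topology of the distance $\mathsf D(\gamma,\eta)=\mathsf d(\gamma_0,\eta_0)+\int_0^1\mathsf d(\gamma_t,\eta_t)\,\mathrm dt$, $\mathsf d$ a bounded distance inducing $\tau$. $\mathsf e_t(\gamma):=\gamma_t$. A causal function is an $\mathfrak m$-measurable $f:M\to\bar{\mathbb R}$ such that $x\le y$ implies $f(x)\le f(y)$. A test plan is a Borel probability measure $\boldsymbol\pi$ on $\mathrm{LCC}([0,1];M)$ such that for some $C>0$, $(\mathsf e_t)_*\boldsymbol\pi\le C\mathfrak m$ for all $t\in[0,1]$. A Borel $G:M\to[0,+\infty]$ is a weak subslope of $f$ if $\int[f(\gamma_1)-f(\gamma_0)]\,\mathrm d\boldsymbol\pi(\gamma)\ge\iint_0^1G(\gamma_t)|\dot\gamma_t|\,\mathrm dt\,\mathrm d\boldsymbol\pi(\gamma)$ for every test plan $\boldsymbol\pi$. *)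

(* Defs.v *)
From HB Require Import structures.
From mathcomp Require Import all_boot all_order all_algebra.
From mathcomp Require Import all_classical all_reals all_analysis.
From mathcomp Require Import measurable_realfun.

Set Implicit Arguments.
Unset Strict Implicit.
Unset Printing Implicit Defensive.

Import Order.TTheory GRing.Theory Num.Theory.
Import numFieldNormedType.Exports.

Local Open Scope classical_set_scope.
Local Open Scope ring_scope.
Local Open Scope ereal_scope.

(* Arithmetic on \bar R with the conventions of the theory, which differ from
   the library's on indeterminate forms: an infinite left summand absorbs
   (oo + z = oo and -oo + z = -oo for every z), while oo - oo = oo and
   (-oo) - (-oo) = oo. *)
Definition addel {R : realType} (x y : \bar R) : \bar R :=
  if x is _%:E then x + y else x.

Definition subel {R : realType} (x y : \bar R) : \bar R :=
  match x, y with
  | +oo, +oo => +oo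
  | -oo, -oo => +oo
  | _, _ => x - y
  end.

Record time_separation (R : realType) (M : Type) := TimeSeparation {
  tsep :> M -> M -> \bar R ;
  tsep_codom : forall x y, tsep x y = -oo \/ 0 <= tsep x y ;
  tsep_diag : forall x, tsep x x = 0 ;
  tsep_triangle : forall x y z,
    Order.min (addel (tsep x y) (tsep y z)) (addel (tsep y z) (tsep x y))
      <= tsep x z
}.

Definition causal_le {R : realType} {M : Type} (l : time_separation R M) :
  rel M := fun x y => 0 <= l x y.

Record metrizes {R : realType} {M : topologicalType} (d : M -> M -> R) :
    Prop := Metrizes {
  metrizes_ge0 : forall x y, (0 <= d x y)%R ;
  metrizes_eq0 : forall x y, d x y = 0%R <-> x = y ;
  metrizes_sym : forall x y, d x y = d y x ;
  metrizes_triangle : forall x y z, (d x z <= d x y + d y z)%R ;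
  metrizes_open : forall A : set M, open A <->
    forall x, A x -> exists2 e : R, (0 < e)%R & [set y | (d x y < e)%R] `<=` A
}.

Definition bounded_dist {R : realType} {M : Type} (d : M -> M -> R) : Prop :=
  exists C : R, forall x y, (d x y <= C)%R.

Definition complete_dist {R : realType} {M : topologicalType}
    (d : M -> M -> R) : Prop :=
  forall u : nat -> M,
    (forall e : R, (0 < e)%R -> exists N : nat, forall i j : nat,
        (N <= i)%N -> (N <= j)%N -> (d (u i) (u j) < e)%R) ->
    exists x : M, u @ \oo --> x.

Definition separable (M : topologicalType) : Prop :=
  exists2 S : set M, countable S & dense S.

Definition polish (R : realType) (M : topologicalType) : Prop :=
  separable M /\ exists2 d : M -> M -> R, metrizes d & complete_dist d.

Definition borel (M : ptopologicalType) := g_sigma_algebraType (@open M).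

Definition radon {R : realType} {M : ptopologicalType}
    (m : {measure set (borel M) -> \bar R}) : Prop :=
  (forall x : M, exists U : set M, [/\ open U, U x & m U < +oo]) /\
  (forall A : set (borel M), measurable A ->
     m A = ereal_sup [set m K | K in [set K : set M | compact K /\ K `<=` A]]).

Record metric_measure_spacetime {R : realType} {M : ptopologicalType}
    (l : time_separation R M) (m : {measure set (borel M) -> \bar R}) :
    Prop := MetricMeasureSpacetime {
  mms_polish : polish R M ;
  mms_refl : reflexive (causal_le l) ;
  mms_antisym : antisymmetric (causal_le l) ;
  mms_trans : transitive (causal_le l) ;
  mms_closed : closed [set p : M * M | causal_le l p.1 p.2] ;
  mms_radon : radon m ;
  mms_nonzero : m setT != 0
}.

Section curves.
Context {R : realType} {M : ptopologicalType} (l : time_separation R M).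

Definition unit_interval := {t : R | (0 <= t <= 1)%R}.

Lemma unit_interval0_subproof : (0 <= (0 : R) <= 1)%R.
Proof. by rewrite lexx ler01. Qed.

Definition unit_interval0 : unit_interval :=
  exist _ 0%R unit_interval0_subproof.

(* Evaluation at a real time; the value outside [0, 1], namely c 0, is junk. *)
Definition at_time (c : unit_interval -> M) (t : R) : M :=
  c (insubd unit_interval0 t).

Definition causal_curve (c : unit_interval -> M) : Prop :=
  forall s t : unit_interval, (val s <= val t)%R -> causal_le l (c s) (c t).

Definition left_continuous (c : unit_interval -> M) : Prop :=
  forall t : R, (0 < t <= 1)%R -> at_time c s @[s --> t^'-] --> at_time c t.

Record LCC := MkLCC {
  curve :> unit_interval -> M ;
  curve_causal : causal_curve curve ;
  curve_left_continuous : left_continuous curve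
}.

Lemma const_curve_causal (x : M) : causal_curve (fun=> x).
Proof. by move=> s t _; rewrite /causal_le tsep_diag. Qed.

Lemma const_curve_left_continuous (x : M) : left_continuous (fun=> x).
Proof. by move=> t _; exact: cvg_cst. Qed.

Definition const_LCC (x : M) : LCC :=
  MkLCC (@const_curve_causal x) (@const_curve_left_continuous x).

Definition eval (t : R) (c : LCC) : borel M := at_time c t.

(* [restricted_speed c nu]: the Borel measure nu, viewed as a measure on the
   real line carried by [0, 1], satisfies nu (a, b) <= l (c a) (c b) *)
Definition restricted_speed (c : LCC)
    (nu : {measure set (measurableTypeR R) -> \bar R}) : Prop :=
  nu (~` [set` `[0%R, 1%R]]) = 0 /\
  forall a b : R, (0 <= a)%R -> (a < b)%R -> (b <= 1)%R ->
    nu [set` `]a, b[] <= l (eval a c) (eval b c).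

Definition speed_measure (c : LCC)
    (nu : {measure set (measurableTypeR R) -> \bar R}) : Prop :=
  restricted_speed c nu /\
  forall nu' : {measure set (measurableTypeR R) -> \bar R},
    restricted_speed c nu' -> forall A, measurable A -> nu' A <= nu A.

(* The absolutely continuous part of nu is the largest absolutely continuous
   measure below nu. This is the Lebesgue one whenever nu has a Lebesgue
   decomposition, but it also makes sense for measures with no such
   decomposition, such as oo times the counting measure, which is the largest
   measure in question if l (c a) (c b) = oo whenever a < b. *)
Definition ac_part (nu nua : {measure set (measurableTypeR R) -> \bar R}) :
    Prop :=
  [/\ nua `<< @lebesgue_measure R,
      (forall A, measurable A -> nua A <= nu A) &
      forall mu : {measure set (measurableTypeR R) -> \bar R},
        mu `<< @lebesgue_measure R ->
        (forall A, measurable A -> mu A <= nu A) ->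
        forall A, measurable A -> mu A <= nua A].

Definition lebesgue_density
    (mu : {measure set (measurableTypeR R) -> \bar R})
    (v : R -> \bar R) : Prop :=
  [/\ measurable_fun [set: R] v, (forall t, 0 <= v t) &
      forall A, measurable A -> mu A = \int[lebesgue_measure]_(t in A) v t].

Definition is_causal_speed (c : LCC) (v : R -> \bar R) :
    Prop :=
  exists nu nua : {measure set (measurableTypeR R) -> \bar R},
    [/\ speed_measure c nu, ac_part nu nua & lebesgue_density nua v].

(* A choice among the a.e. equal functions satisfying [is_causal_speed c]. *)
Definition causal_speed (c : LCC) : R -> \bar R :=
  xget (cst 0) [set v | is_causal_speed c v].

Definition LCC_dist (d : M -> M -> R) (c c' : LCC) : \bar R :=
  (d (eval 0 c) (eval 0 c'))%:E +
  \int[lebesgue_measure]_(t in `[0%R, 1%R]) (d (eval t c) (eval t c'))%:E.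

Definition LCC_open (d : M -> M -> R) : set (set LCC) :=
  [set U | forall c, U c ->
     exists2 e : R, (0 < e)%R & [set c' | LCC_dist d c c' < e%:E] `<=` U].

End curves.

HB.instance Definition _ (R : realType) (M : ptopologicalType)
  (l : time_separation R M) := gen_eqMixin (LCC l).
HB.instance Definition _ (R : realType) (M : ptopologicalType)
  (l : time_separation R M) := gen_choiceMixin (LCC l).
HB.instance Definition _ (R : realType) (M : ptopologicalType)
  (l : time_separation R M) := isPointed.Build (LCC l) (const_LCC l point).

Definition borel_LCC {R : realType} {M : ptopologicalType}
  (l : time_separation R M) (d : M -> M -> R) :=
  g_sigma_algebraType (@LCC_open R M l d).

(* [completed_algebra_gen m] is the sigma-algebra of m-measurable sets, i.e.,
   of unions of a Borel set and an m-negligible set. *)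
Record causal_function {R : realType} {M : ptopologicalType}
    (l : time_separation R M) (m : {measure set (borel M) -> \bar R})
    (f : M -> \bar R) : Prop := CausalFunction {
  causal_measurable : forall B : set (\bar R), measurable B ->
    completed_algebra_gen m (f @^-1` B) ;
  causal_monotone : forall x y, causal_le l x y -> f x <= f y
}.

Definition test_plan {R : realType} {M : ptopologicalType}
    (l : time_separation R M) (m : {measure set (borel M) -> \bar R})
    (d : M -> M -> R) (pi : probability (borel_LCC l d) R) : Prop :=
  exists2 C : R, (0 < C)%R &
    forall t : R, (0 <= t <= 1)%R ->
    forall A : set (borel M), measurable A ->
      pushforward pi (eval t : borel_LCC l d -> borel M) A <= C%:E * m A.

(* Integral of a nonnegative function with respect to (the completion of) mu.
   It is the usual integral as soon as h is measurable with respect to that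
   completion, see [upper_integral_ae], and the upper integral otherwise. By
   contrast, the library's integral of a nonnegative function is the lower
   integral when the function is not measurable. *)
Definition upper_integral {R : realType} (d : measure_display)
    (T : measurableType d) (mu : {measure set T -> \bar R})
    (h : T -> \bar R) : \bar R :=
  ereal_inf [set \int[mu]_x g x | g in
    [set g : T -> \bar R | measurable_fun setT g /\ forall x, h x <= g x]].

Lemma upper_integral_ae {R : realType} (d : measure_display)
    (T : measurableType d) (mu : {measure set T -> \bar R})
    (h k : T -> \bar R) :
  (forall x, 0 <= h x) -> (forall x, 0 <= k x) -> measurable_fun setT k ->
  {ae mu, forall x, h x = k x} ->
  upper_integral mu h = \int[mu]_x k x.
Proof.
move=> h0 k0 mk hk; apply/eqP; rewrite eq_le; apply/andP; split.
- have [N [mN N0 Nhk]] := hk.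
  pose g x := if x \in N then +oo else k x.
  have mg : measurable_fun setT g.
    apply: measurable_fun_ifT => //.
    by apply: (measurable_fun_bool true); rewrite setTI preimage_mem_true.
  have g0 x : 0 <= g x by rewrite /g; case: ifP => // _; rewrite leey.
  have -> : \int[mu]_x k x = \int[mu]_x g x.
    apply: ge0_ae_eq_integral => //.
    exists N; split => // x /= /not_implyP[_ kg].
    by apply: contrapT => Nx; apply: kg; rewrite /g memNset.
  apply: ereal_inf_lbound; exists g => //; split => // x.
  rewrite /g; case: ifPn => [_|]; first exact: leey.
  rewrite notin_setE => Nx; suff -> : h x = k x by [].
  by apply: contrapT => hkx; apply: Nx; exact: Nhk.
- apply: le_ereal_inf_tmp => _ [g [mg hg] <-].
  apply: ae_ge0_le_integral => //.
    by move=> x _; exact: le_trans (hg x).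
  by apply: filterS hk => x hkx _; rewrite -hkx.
Qed.

(* The integrand on the right is nonnegative for causal f, and measurable with
   respect to the completion of every test plan. On the left, the inner
   integrand is measurable; the dependence of the inner integral on the curve
   need not be, since no measurability of l is assumed. *)
Record weak_subslope {R : realType} {M : ptopologicalType}
    (l : time_separation R M) (m : {measure set (borel M) -> \bar R})
    (d : M -> M -> R) (f : M -> \bar R) (G : borel M -> \bar R) :
    Prop := WeakSubslope {
  subslope_measurable : measurable_fun setT G ;
  subslope_ge0 : forall x, 0 <= G x ;
  subslope_le : forall pi : probability (borel_LCC l d) R, test_plan m pi ->
    upper_integral pi (fun c : borel_LCC l d =>
      \int[lebesgue_measure]_(t in `[0%R, 1%R])
        (G (eval t c) * causal_speed c t))
    <= \int[pi]_c subel (f (eval 1 c)) (f (eval 0 c))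
}.

Definition maximal_weak_subslope {R : realType} {M : ptopologicalType}
    (l : time_separation R M) (m : {measure set (borel M) -> \bar R})
    (d : M -> M -> R) (f : M -> \bar R) (G : borel M -> \bar R) : Prop :=
  weak_subslope l m d f G /\
  forall G' : borel M -> \bar R, weak_subslope l m d f G' ->
    {ae m, forall x, G' x <= G x}.

(* Main.v *)
From HB Require Import structures.
Require Import Defs.
From mathcomp Require Import all_boot all_order all_algebra.
From mathcomp Require Import all_classical all_reals all_analysis.
From mathcomp Require Import measurable_realfun.
From mathcomp Require Import ring lra.

(** The weak subslopes of [f] form a family that is stable under countable
suprema, so its essential supremum belongs to it. Stability under maxima is the
heart of the matter. Since the restriction of a test plan to a set of positive
measure is, once normalized, again a test plan, the integral inequality that
defines a weak subslope [G] self-improves to an inequality along almost every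
curve; and since a test plan can be pushed forward by the restriction of curves
to a subinterval, it holds along almost every curve [c] on all intervals
[[s, t]] with rational endpoints:
[f (c t) - f (c s) >= \int_s^t G (c r) |c'(r)| dr]. If this holds for [G1] and
[G2], the inner regularity of the Lebesgue measure yields disjoint compact sets
K1 of [{G1 o c >= G2 o c}] and K2 of its complement; an interval shorter than
their distance meets only one of them, and summing the inequalities over a fine
partition of [[0, 1]] gives the inequality for [max G1 G2].

The causal speed of a restricted curve comes from the maximality of the measure
that defines it: the largest measure of the restriction is the rescaling of the
one of the whole curve on the open interval, together with an infinite mass at
both endpoints, which open intervals do not see. *)

Set Implicit Arguments.
Unset Strict Implicit.
Unset Printing Implicit Defensive.

Import Order.TTheory GRing.Theory Num.Theory.
Import numFieldNormedType.Exports HBNNSimple.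

Local Open Scope classical_set_scope.
Local Open Scope ring_scope.
Local Open Scope ereal_scope.

(* [eval] alone refers to the evaluation of continuous maps. *)
Local Notation eval := Defs.eval.

(** * Measure theory *)

Lemma lt_ereal_rat {R : realType} (x y : \bar R) : x < y ->
  exists q : rat, x <= (ratr q)%:E < y.
Proof.
case: x y => [x| |] [y| |] //.
- rewrite lte_fin => /rat_in_itvoo[q]; rewrite in_itv/= => /andP[xq qy].
  by exists q; rewrite lee_fin lte_fin ltW.
- move=> _; have /rat_in_itvoo[q] : (x < x + 1)%R by rewrite ltrDl.
  by rewrite in_itv/= => /andP[xq _]; exists q; rewrite lee_fin ltW//= ltry.
- move=> _; have /rat_in_itvoo[q] : (y - 1 < y)%R by rewrite gtrDl ltrN10.
  by rewrite in_itv/= => /andP[_ qy]; exists q; rewrite leNye lte_fin.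
- by move=> _; exists 0%R; rewrite leNye ltry.
Qed.

Section measure_theory.
Context d (T : measurableType d) (R : realType).

Lemma ge0_le_integral_pointwise (mu : {measure set T -> \bar R})
    (f g : T -> \bar R) :
  (forall x, 0 <= f x) -> (forall x, f x <= g x) ->
  \int[mu]_x f x <= \int[mu]_x g x.
Proof.
move=> f0 fg; have g0 x : 0 <= g x by exact: le_trans (fg x).
rewrite !ge0_integralTE//; apply: le_ereal_sup => _ [h hf <-].
by exists h => // x; exact: le_trans (fg x).
Qed.

(* [f] need not be measurable: the library's integral is a lower integral. *)
Lemma ge0_ae_measurable_integral (mu : {measure set T -> \bar R})
    (f g : T -> \bar R) :
  (forall x, 0 <= f x) -> (forall x, 0 <= g x) -> measurable_fun setT g ->
  {ae mu, forall x, f x = g x} -> \int[mu]_x f x = \int[mu]_x g x.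
Proof.
move=> f0 g0 mg fg; apply/eqP; rewrite eq_le; apply/andP; split.
- rewrite ge0_integralTE//; apply: ge_ereal_sup => _ [h hf <-].
  rewrite -integralT_nnsfun; apply: ae_ge0_le_integral => //.
      by move=> x _; rewrite lee_fin.
    exact/measurable_EFinP.
  by apply: filterS fg => x <- _; exact: hf.
- have [N [mN N0 fgN]] := fg.
  rewrite (ge0_negligible_integral mN)// setTD integral_mkcond.
  apply: ge0_le_integral_pointwise => x; rewrite patchE; case: ifPn => //.
  rewrite inE => Nx; suff -> : f x = g x by [].
  by apply: contrapT => fgx; apply: Nx; exact: fgN.
Qed.

(** Measurable supersets of [A] whose probabilities tend to the infimum have an intersection that
    attains it. Cutting this intersection by one more measurable superset cannot lower its measure,
    so the part cut off is null. *)
Lemma measurable_envelope (P : probability T R) (A : set T) :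
  exists B, [/\ measurable B, A `<=` B &
    forall C, measurable C -> A `<=` C -> P (B `\` C) = 0].
Proof.
pose S := [set P B | B in [set B | measurable B /\ A `<=` B]].
have iS : ereal_inf S \is a fin_num.
  rewrite ge0_fin_numE; last by apply: le_ereal_inf_tmp => _ [B _ <-].
  apply: (@le_lt_trans _ _ 1); last exact: ltry.
  by rewrite -(probability_setT P); apply: ereal_inf_lbound; exists setT.
have /choice[B /all_and3[mB AB PB]] n : exists B, [/\ measurable B, A `<=` B &
    P B <= ereal_inf S + (n.+1%:R^-1)%:E].
  have n0 : (0 < n.+1%:R^-1 :> R)%R by rewrite invr_gt0.
  by have [_ [B [mB AB] <-] /ltW] := lb_ereal_inf_adherent n0 iS; exists B.
have mIB : measurable (\bigcap_n B n) by exact: bigcap_measurableType.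
exists (\bigcap_n B n); split => //; first by move=> x Ax n _; exact: AB.
move=> C mC AC.
have PI : P (\bigcap_n B n) <= ereal_inf S.
  apply/lee_addgt0Pr => e e0.
  pose n := Num.trunc e^-1.
  have ne : (n.+1%:R^-1 <= e)%R.
    by rewrite invf_ple ?posrE// ltW// truncnS_gt.
  apply: le_trans (le_trans (PB n) _); last by rewrite leeD2l// lee_fin.
  by apply: le_measure; rewrite ?inE//; exact: bigcap_inf.
have PC : ereal_inf S <= P (\bigcap_n B n `&` C).
  apply: ereal_inf_lbound; exists (\bigcap_n B n `&` C) => //; split.
    exact: measurableI.
  by move=> x Ax; split; [move=> n _; exact: AB|exact: AC].
apply/eqP; rewrite eq_le measure_ge0 andbT.
have := le_trans PI PC; rewrite (measureDI _ mIB mC).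
rewrite -leeBrDr; last by rewrite fin_num_measure//; exact: measurableI.
by rewrite subee// fin_num_measure//; exact: measurableI.
Qed.

(** Wherever [F x < H x], two rationals [p < q] fit between the values, so the exceptional set is
    covered by countably many null sets. [H] may be non-measurable: it will be the weighted length
    of a curve. *)
Lemma ae_le_rat (mu : {measure set T -> \bar R}) (H F : T -> \bar R) :
  (forall p q : rat, (p < q)%R ->
    mu.-negligible [set x | F x <= (ratr p)%:E /\ (ratr q)%:E <= H x]) ->
  {ae mu, forall x, H x <= F x}.
Proof.
move=> null.
pose N (k : nat) := if (unpickle k : option (rat * rat)) is Some (p, q) then
  if (p < q)%R then [set x | F x <= (ratr p)%:E /\ (ratr q)%:E <= H x] else set0
  else set0.
have Nnull : mu.-negligible (\bigcup_k N k).
  apply: negligible_bigcup => k; rewrite /N.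
  case: unpickle => [[p q]|]; last exact: negligible_set0.
  by case: ifPn => [/null//|_]; exact: negligible_set0.
apply: negligibleS Nnull => x /= /negP; rewrite -ltNge => FH.
have [q0 /andP[Fq q0H]] := lt_ereal_rat FH.
have [q /andP[q0q qH]] : exists q : rat, (q0 < q)%R && ((ratr q)%:E <= H x).
  case: (H x) q0H => [h| |]//.
    rewrite lte_fin => /rat_in_itvoo[q]; rewrite in_itv/= ltr_rat => /andP[? ?].
    by exists q; rewrite lee_fin ltW// andbT.
  by move=> _; exists (q0 + 1)%R; rewrite ltrDl ltr01 leey.
exists (pickle (q0, q)); first exact: Logic.I.
by rewrite /N pickleK q0q.
Qed.

(** If [F <= p < q <= H] on a non-negligible set [A], condition [P] on a measurable envelope of [A].
    Every measurable majorant of [H] is at least [q] almost everywhere there, so the upper integral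
    of [H] is at least [q], while [F] integrates to at most [p]. *)
Lemma ae_le_of_integrals (P : probability T R) (H F : T -> \bar R) :
  measurable_fun setT F -> (forall x, 0 <= F x) ->
  (forall Q : probability T R,
     (exists2 C : R, (0 < C)%R &
       forall A, measurable A -> Q A <= C%:E * P A) ->
     upper_integral Q H <= \int[Q]_x F x) ->
  {ae P, forall x, H x <= F x}.
Proof.
move=> mF F0 HF; apply: ae_le_rat => p q pq; set A := [set x | _].
have [B0 [mB0 AB0 PB0]] := measurable_envelope P A.
(* The envelope may leave the region [F <= p]; this measurable cut brings it back and still contains
   [A]. *)
pose B := B0 `&` [set x | F x <= (ratr p)%:E].
have mB : measurable B.
  apply: measurableI => //; rewrite -[X in measurable X]setTI.
  exact: emeasurable_fun_infty_c.
have AB : A `<=` B by move=> x Ax; split; [exact: AB0|case: Ax].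
exists B; split => //; apply/eqP; apply: contraT => PB.
have PBfin : P B \is a fin_num by exact: fin_num_measure.
have B_gt0 : (0 < fine (P B))%R.
  by rewrite fine_gt0// lt0e PB measure_ge0 ltey_eq PBfin.
pose Q := mnormalize (mrestr P mB) P.
have QE U : Q U = P (U `&` B) * (fine (P B))^-1%:E.
  rewrite /Q /= /mnormalize /= /mrestr setTI (negbTE PB)/=.
  by rewrite ifF//; apply/negbTE; rewrite -ltey ltey_eq PBfin.
have Qnull U : P (U `&` B) = 0 -> Q U = 0.
  by move=> UB; rewrite QE UB mul0e.
have /HF : exists2 C : R, (0 < C)%R &
    forall A, measurable A -> Q A <= C%:E * P A.
  exists (fine (P B))^-1%R; first by rewrite invr_gt0.
  move=> U mU; rewrite QE muleC lee_pmul2l//; last by rewrite lte_fin invr_gt0.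
  by apply: le_measure; rewrite ?inE//; exact: measurableI.
(* A point of [B] gives [0 <= F x <= p], hence the signs of [p] and [q]. *)
have [[x Bx]|] := pselect (B !=set0); last first.
  move/set0P/negP/negPn/eqP => B00.
  by exfalso; move/eqP: (PB); apply; rewrite B00 measure0.
have p0 : (0 <= ratr p :> R)%R.
  by rewrite -lee_fin; exact: le_trans (F0 x) Bx.2.
have q0 : (0 <= ratr q :> R)%R by rewrite (le_trans p0)// ler_rat ltW.
have : \int[Q]_x F x <= (ratr p)%:E.
  rewrite -[leRHS]mule1 -[X in _ * X](probability_setT Q) -integral_cst//.
  apply: ae_ge0_le_integral => //.
  exists (~` B); split; first exact: measurableC.
    by apply: Qnull; rewrite setICl measure0.
  by move=> y /= nFp [_ Bp]; apply: nFp.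
have : (ratr q)%:E <= upper_integral Q H.
  apply: le_ereal_inf_tmp => _ [g [mg Hg] <-].
  pose C := [set x | (ratr q)%:E <= g x].
  have mC : measurable C.
    by rewrite -[C]setTI; exact: emeasurable_fun_c_infty.
  have PBC : P (B `\` C) = 0.
    apply: (@subset_measure0 _ _ _ P _ (B0 `\` C)).
    - exact: measurableD.
    - exact: measurableD.
    - by move=> y [[]].
    - by apply: PB0 => // y Ay; rewrite /C/= (le_trans _ (Hg y))//; case: Ay.
  (* The majorant [g] carries no sign of its own, but [g >= q >= 0] on [B] and [C], which has full
     [Q]-measure; hence its negative part integrates to 0. *)
  have gpos : \int[Q]_x (g ^\+ x) <= \int[Q]_x g x.
    rewrite [leRHS]integralE.
    suff -> : \int[Q]_x g^\- x = 0 by rewrite sube0.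
    rewrite (_ : 0 = \int[Q]_x cst 0 x); last by rewrite integral0.
    apply: ge0_ae_eq_integral => //; first exact: measurable_funeneg.
    exists (~` (B `&` C)); split.
    - exact/measurableC/measurableI.
    - apply: Qnull; rewrite (_ : _ `&` _ = B `\` C) ?PBC//.
      by apply/seteqP; split=> y /=; rewrite /setD/=; tauto.
    - apply: subsetC => y [By Cy] _ /=.
      by rewrite funenegE; apply/max_idPr; rewrite leeNl oppe0 (le_trans _ Cy)// lee_fin.
  apply: le_trans gpos.
  rewrite -[leLHS]mule1 -[X in _ * X](probability_setT Q) -integral_cst//.
  apply: ae_ge0_le_integral => //; first exact: measurable_funepos.
  exists (~` (B `&` C)); split.
  - exact/measurableC/measurableI.
  - apply: Qnull; rewrite (_ : _ `&` _ = B `\` C) ?PBC//.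
    by apply/seteqP; split=> y /=; rewrite /setD/=; tauto.
  - by apply: subsetC => y [By Cy] _ /=; rewrite funeposE le_max Cy.
move=> qH Fp HFQ.
have := le_trans qH (le_trans HFQ Fp).
by rewrite lee_fin ler_rat leNgt pq.
Qed.

(** Exhaustion: for each piece [F n] of finite measure and each rational [q], pick members of [S]
    that nearly maximize the measure of the superlevel set [E n q]. The supremum [G] of all of them
    maximizes every such measure at once, so no member of [S] can exceed [G] on a set of positive
    measure. *)
Lemma ess_max_countable_sup (m : {measure set T -> \bar R})
    (S : set (T -> \bar R)) : sigma_finite setT m -> S !=set0 ->
  (forall g, S g -> measurable_fun setT g) ->
  (forall u : nat -> T -> \bar R, (forall n, S (u n)) ->
     S (fun x => ereal_sup (range (u ^~ x)))) ->
  exists2 G, S G & forall g, S g -> {ae m, forall x, g x <= G x}.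
Proof.
move=> [F FT mF] [g0 Sg0] mS supS.
pose E (n : nat) (q : rat) (g : T -> \bar R) :=
  F n `&` [set x | (ratr q)%:E < g x].
have mE n q g : S g -> measurable (E n q g).
  by move=> Sg; apply: emeasurable_fun_o_infty; [exact: (mF n).1|
    apply: measurable_funS (mS _ Sg)].
have Efin n q g : S g -> m (E n q g) < +oo.
  move=> Sg; apply: le_lt_trans (mF n).2; apply: le_measure; rewrite ?inE//.
  - exact: mE.
  - exact: (mF n).1.
  - exact: subIsetl.
pose s n q := ereal_sup [set m (E n q g) | g in S].
have sfin k q : s k q \is a fin_num.
  rewrite ge0_fin_numE.
    apply: le_lt_trans (mF k).2; apply: ge_ereal_sup => _ [g Sg <-].
    apply: le_measure; rewrite ?inE//; [exact: mE|exact: (mF k).1|exact: subIsetl].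
  apply: (@le_trans _ _ (m (E k q g0))) => //.
  by apply: ereal_sup_ubound; exists g0.
(* The third index [i] is the precision: the supremum is reached up to [1/(i+1)]. *)
have /choice[u u_] (i : nat * rat * nat) : exists g, S g /\
    s i.1.1 i.1.2 - (i.2.+1%:R^-1)%:E < m (E i.1.1 i.1.2 g).
  have i0 : (0 < i.2.+1%:R^-1 :> R)%R by rewrite invr_gt0.
  by have [_ [g Sg <-] ?] := ub_ereal_sup_adherent i0 (sfin i.1.1 i.1.2); exists g.
pose v k := if unpickle k is Some i then u i else g0.
have Sv k : S (v k) by rewrite /v; case: unpickle => // i; case: (u_ i).
pose G x := ereal_sup (range (v ^~ x)).
have SG : S G by exact: supS.
have uG i x : u i x <= G x.
  apply: ereal_sup_ubound; exists (pickle i); first exact: Logic.I.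
  by rewrite /v pickleK.
exists G => // g Sg.
(* [W] is the maximum of [g] and [G], written as the supremum of the sequence [g, G, G, ...] so that
   closure under countable suprema puts it in [S]. *)
pose W x := ereal_sup (range ((fun n => if n is 0%N then g else G) ^~ x)).
have SW : S W by apply: supS => -[].
have gW x : g x <= W x by apply: ereal_sup_ubound; exists 0%N.
have GW x : G x <= W x by apply: ereal_sup_ubound; exists 1%N.
have null n q : m (E n q W `\` E n q G) = 0.
  have sG : s n q <= m (E n q G).
    apply/lee_addgt0Pr => e e0.
    pose k := Num.trunc e^-1.
    have ke : (k.+1%:R^-1 <= e)%R.
      by rewrite invf_ple ?posrE// ltW// truncnS_gt.
    have [Su /= /ltW] := u_ (n, q, k).
    rewrite EFinN leeBlDr// => /le_trans; apply.
    rewrite leeD ?lee_fin//; apply: le_measure; rewrite ?inE//; try exact: mE.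
    by move=> x [Fx qu]; split => //=; exact: lt_le_trans qu (uG _ x).
  have EGW : E n q G `<=` E n q W.
    by move=> x [Fx qG]; split => //=; exact: lt_le_trans qG (GW x).
  rewrite measureD; [|exact: mE|exact: mE|exact: Efin].
  rewrite (setIidr EGW); apply/eqP; rewrite eq_le.
  have Gfin : m (E n q G) \is a fin_num by rewrite ge0_fin_numE//; exact: Efin.
  apply/andP; split.
    rewrite leeBlDr// add0e; apply: le_trans sG.
    by apply: ereal_sup_ubound; exists W.
  rewrite sube_ge0 ?Gfin//.
  by apply: le_measure; rewrite ?inE//; exact: mE.
pose N k := if (unpickle k : option (nat * rat)) is Some (n, q)
  then E n q W `\` E n q G else set0.
have : m.-negligible (\bigcup_k N k).
  apply: negligible_bigcup => k; rewrite /N.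
  case: unpickle => [[n q]|]; last exact: negligible_set0.
  by exists (E n q W `\` E n q G); split => //; apply: measurableD; exact: mE.
apply: negligibleS => x /= /negP; rewrite -ltNge => Gg.
have [q /andP[Gq qg]] := lt_ereal_rat Gg.
have [n _ Fx] : (\bigcup_n F n) x by rewrite -FT.
exists (pickle (n, q)); first exact: Logic.I.
rewrite /N pickleK; split.
  by split => //=; exact: lt_le_trans qg (gW x).
by move=> [_ /=]; rewrite ltNge Gq.
Qed.

(** Each set [f > q] is a measurable [A q] up to a negligible [Z q]. One measurable null set [N]
    covers all the [Z q], and setting [g] to [+oo] on [N] puts [N] inside every superlevel set of
    [g], which becomes [N] together with the [A q] minus [N] for [q >= r]. *)
Lemma completion_measurable_representative (m : {measure set T -> \bar R})
    (f : T -> \bar R) :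
  (forall B, measurable B -> completed_algebra_gen m (f @^-1` B)) ->
  exists2 g : T -> \bar R, measurable_fun setT g & {ae m, forall x, f x = g x}.
Proof.
move=> mf.
have /choice[A /choice[Z AZ]] (q : rat) : exists A Z, [/\ measurable A,
    m.-negligible Z & A `|` Z = f @^-1` `](ratr q)%:E, +oo[%classic].
  have [A mA [Z nZ AZ]] := mf _ (emeasurable_itv `](ratr q)%:E, +oo[).
  by exists A, Z.
have : m.-negligible (\bigcup_k (if unpickle k is Some q then Z q else set0)).
  apply: negligible_bigcup => k; case: unpickle => [q|]; first by have [] := AZ q.
  exact: negligible_set0.
move=> [N [mN N0 ZN]].
have {}ZN q : Z q `<=` N.
  move=> x Zx; apply: ZN; exists (pickle q); first exact: Logic.I.
  by rewrite pickleK.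
pose g x := if x \in N then +oo else f x.
exists g; last first.
  exists N; split => // x /= fg; apply: contrapT => Nx; apply: fg.
  by rewrite /g memNset.
move=> _; apply: (measurability _ (ErealGenOInfty.measurableE R)) => //.
move=> _ [_ [r ->] <-]; rewrite setTI.
rewrite (_ : _ @^-1` _ = N `|` \bigcup_(q : rat)
    (if (r <= ratr q)%R then A q `\` N else set0)).
  apply: measurableU => //; apply: bigcupT_measurable_rat => q.
  by case: ifP => // _; apply: measurableD => //; case: (AZ q).
apply/seteqP; split => x /=.
  rewrite in_itv/= andbT /g; case: ifPn; first by rewrite inE; left.
  rewrite notin_setE => Nx /lt_ereal_rat[q /andP[rq qf]]; right.
  exists q => //; rewrite lee_fin in rq; rewrite rq; split => //.
  have : (A q `|` Z q) x.
    by have [_ _ ->] := AZ q; rewrite /= in_itv/= qf.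
  by case=> // /ZN.
rewrite in_itv/= andbT /g => -[/mem_set ->|[q _]]; first by rewrite ltry.
case: ifPn => // rq [Aq Nx]; rewrite memNset//.
have : (A q `|` Z q) x by left.
have [_ _ ->] := AZ q; rewrite /= in_itv/= andbT.
by apply: le_lt_trans; rewrite lee_fin.
Qed.

End measure_theory.

(** On a set of finite measure where [w <= p < q <= v], comparing integrals gives [q] times the
    measure at most [p] times it, so the measure is 0. *)
Lemma ae_le_of_integrals_sigma_finite d (T : measurableType d) (R : realType)
    (mu : {measure set T -> \bar R}) (v w : T -> \bar R) :
  sigma_finite setT mu -> measurable_fun setT v -> measurable_fun setT w ->
  (forall x, 0 <= v x) -> (forall x, 0 <= w x) ->
  (forall A, measurable A -> \int[mu]_(x in A) v x <= \int[mu]_(x in A) w x) ->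
  {ae mu, forall x, v x <= w x}.
Proof.
move=> [F FT mF] mv mw v0 w0 vw; apply: ae_le_rat => p q pq.
have : mu.-negligible (\bigcup_n (F n `&`
    ([set x | w x <= (ratr p)%:E] `&` [set x | (ratr q)%:E <= v x]))).
  apply: negligible_bigcup => n; set A := _ `&` _.
  have mA : measurable A.
    apply: measurableI; first exact: (mF n).1.
    apply: measurableI; rewrite -[X in measurable X]setTI.
      exact: emeasurable_fun_infty_c.
    exact: emeasurable_fun_c_infty.
  exists A; split => //.
  have Afin : mu A \is a fin_num.
    rewrite ge0_fin_numE//; apply: le_lt_trans (mF n).2.
    by apply: le_measure; rewrite ?inE//; [exact: (mF n).1|exact: subIsetl].
  apply/eqP; apply: contraT => A0.
  have A_gt0 : (0 < fine (mu A))%R.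
    by rewrite fine_gt0// lt0e A0 measure_ge0 ltey_eq Afin.
  have [[x Ax]|] := pselect (A !=set0); last first.
    by move/set0P/negP/negPn/eqP => A00; move: A0; rewrite A00 measure0 eqxx.
  have p0 : (0 <= ratr p :> R)%R.
    by rewrite -lee_fin; exact: le_trans (w0 x) Ax.2.1.
  have q0 : (0 <= ratr q :> R)%R by rewrite (le_trans p0)// ler_rat ltW.
  have qA : (ratr q)%:E * mu A <= \int[mu]_(x in A) v x.
    rewrite -integral_cst//; apply: ge0_le_integral => //.
    - exact: measurable_funS mv.
    - by move=> y [_ []].
  have Ap : \int[mu]_(x in A) w x <= (ratr p)%:E * mu A.
    rewrite -integral_cst//; apply: ge0_le_integral => //.
    - exact: measurable_funS mw.
    - by move=> y [_ []].
  have := le_trans qA (le_trans (vw _ mA) Ap).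
  by rewrite -(fineK Afin) -!EFinM lee_fin ler_pM2r// ler_rat leNgt pq.
apply: negligibleS => x [wp qv].
have [n _ Fx] : (\bigcup_n F n) x by rewrite -FT.
by exists n.
Qed.

Definition image_measure d d' (T : measurableType d) (T' : measurableType d')
    (R : realFieldType) (mu : {measure set T -> \bar R}) (f : T -> T')
    (mf : measurable_fun setT f) : {measure set T' -> \bar R}.
Proof.
by refine (pushforward mu f : {measure set T' -> \bar R}).
Defined.

(** * Affine changes of variable for the Lebesgue measure *)

Section affine.
Context (R : realType).
Local Notation mu := (@lebesgue_measure R).
Variables (a b : R).
Hypothesis a0 : (0 < a)%R.
Let T (x : measurableTypeR R) : measurableTypeR R := (a * x + b)%R.

Let mT : measurable_fun setT T.
Proof. by apply: measurable_funD => //; exact: measurable_funM. Qed.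

Lemma preimage_affine_itv x y :
  T @^-1` `]x, y] = `]((x - b) / a)%R, ((y - b) / a)%R]%classic.
Proof.
apply/seteqP; split=> z /=; rewrite !in_itv/= /T.
  by rewrite ltr_pdivrMr// ler_pdivlMr// ltrBlDr lerBrDr mulrC.
by rewrite ltr_pdivrMr// ler_pdivlMr// ltrBlDr lerBrDr mulrC.
Qed.

(** The rescaled image measure agrees with the Lebesgue measure on half-open intervals, and this
    determines the latter. *)
Lemma lebesgue_measure_affine A : measurable A ->
  mu A = a%:E * mu (T @^-1` A).
Proof.
move=> mA.
pose nu : {measure set (measurableTypeR R) -> \bar R} :=
  mscale (NngNum (ltW a0)) (image_measure mu mT).
rewrite (@lebesgue_measure_unique _ nu)//.
move=> _ [[x y] _ <-] /=; rewrite /nu /mscale/= /pushforward.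
rewrite preimage_affine_itv !lebesgue_measure_itv/= !lte_fin.
rewrite ltr_pM2r ?invr_gt0// ltrD2r; case: ifPn => _; last by rewrite mule0.
rewrite -!EFinB -EFinM; congr EFin.
have a_neq0 : a != 0%R by rewrite gt_eqF.
by clear nu; field.
Qed.

Lemma ge0_integral_affine (D : set R) (g : R -> \bar R) : measurable D ->
  measurable_fun D g -> (forall x, D x -> 0 <= g x) ->
  \int[mu]_(x in D) g x = a%:E * \int[mu]_(x in T @^-1` D) g (T x).
Proof.
move=> mD mg g0.
pose nu : {measure set (measurableTypeR R) -> \bar R} :=
  mscale (NngNum (ltW a0)) (image_measure mu mT).
rewrite (@eq_measure_integral _ _ _ _ nu); last first.
  by move=> A mA _; exact: lebesgue_measure_affine.
rewrite ge0_integral_mscale//= ge0_integral_pushforward//.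
by move=> y; rewrite inE; exact: g0.
Qed.

End affine.

(** * Increments dominating two integrals *)

Lemma integral_ereal_sup_le d (T : measurableType d) (R : realType)
    (mu : {measure set T -> \bar R}) (D : set T) (g : nat -> T -> \bar R)
    (c : \bar R) : measurable D ->
  (forall n, measurable_fun D (g n)) -> (forall n x, D x -> 0 <= g n x) ->
  (forall x, D x -> nondecreasing_seq (g ^~ x)) ->
  (forall n, \int[mu]_(x in D) g n x <= c) ->
  \int[mu]_(x in D) ereal_sup (range (g ^~ x)) <= c.
Proof.
move=> mD mg g0 ndg gc.
rewrite (eq_integral (fun x => limn (g ^~ x))); last first.
  move=> x; rewrite inE => Dx; apply/esym/cvg_lim => //.
  exact/ereal_nondecreasing_cvgn/ndg.
rewrite monotone_convergence//; apply: lime_le; last exact: nearW.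
apply: ereal_nondecreasing_is_cvgn => i j ij.
by apply: ge0_le_integral => // [x Dx|x Dx]; [exact: g0|exact: ndg].
Qed.

(** Both indeterminate differences equal [+oo], so increments of a causal function are nonnegative
    at infinite values too. *)
Lemma subel_ge0 (R : realType) (x y : \bar R) : y <= x -> 0 <= subel x y.
Proof.
case: x y => [x| |] [y| |] //=; rewrite ?leey//.
by rewrite !lee_fin subr_ge0.
Qed.

Lemma ereal_sup_mine (R : realType) (x : \bar R) : 0 <= x ->
  ereal_sup (range (fun n : nat => mine x n%:R%:E)) = x.
Proof.
move=> x0; apply/eqP; rewrite eq_le; apply/andP; split.
  by apply: ge_ereal_sup => _ [n _ <-]; rewrite ge_min lexx.
case: x x0 => [r| |]// x0.
  apply: ereal_sup_ubound; exists (Num.trunc r).+1 => //=.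
  by apply/min_idPl; rewrite lee_fin ltW// truncnS_gt.
rewrite leye_eq; apply/eqP/eq_infty => r.
apply: (@le_trans _ _ (Num.trunc r).+1%:R%:E).
  by rewrite lee_fin ltW// truncnS_gt.
by apply: ereal_sup_ubound; exists (Num.trunc r).+1.
Qed.

Section superadditive_increments.
Context (R : realType).
Local Notation mu := (@lebesgue_measure R).
Implicit Types (phi g : R -> \bar R).

(** Rational endpoints make this a countable family of conditions, which can hold simultaneously
    along almost every curve. *)
Definition dominates_on_rational_itv phi g := forall s t : rat,
  (0 <= s)%R -> (s < t)%R -> (t <= 1)%R ->
  \int[mu]_(x in `[ratr s, ratr t]) g x <= subel (phi (ratr t)) (phi (ratr s)).

(** The separation has the form [1/(N+1)] because it serves as the mesh of a uniform partition of
    the unit interval. *)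
Lemma compact_separation (K1 K2 : set R) : compact K1 -> compact K2 ->
  K1 `&` K2 = set0 ->
  exists N : nat, forall x y, K1 x -> K2 y -> (N.+1%:R^-1 < `|x - y|)%R.
Proof.
move=> /compact_near_coveringP cK1 cK2 K12.
have /cK1 : forall x, K1 x -> \forall x' \near x & n \near \oo,
    forall y, K2 y -> (n.+1%:R^-1 < `|x' - y|)%R.
  move=> x K1x.
  have : nbhs x (~` K2).
    apply: open_nbhs_nbhs; split.
      by apply/closed_openC; apply: compact_closed => //; exact: norm_hausdorff.
    by move=> K2x; have : (K1 `&` K2) x by []; rewrite K12.
  move=> /nbhs_ballP[e /= e0 xe].
  have e20 : (0 < e / 2)%R by rewrite divr_gt0.
  exists (ball x (e / 2), [set n | (n.+1%:R^-1 < e / 2)%R]).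
    split; first exact: nbhsx_ballx.
    have := near_infty_natSinv_lt (PosNum e20); exact.
  move=> [x' n] /= [xx' ne] y K2y; rewrite ltNge; apply/negP => x'y.
  apply: (xe y) => //=.
  rewrite /ball/= in xx' *.
  rewrite (le_lt_trans (ler_distD x' _ _))// [ltRHS](splitr e) ltrD//.
  exact: le_lt_trans ne.
move=> [n _ H]; exists n => x y K1x K2y.
exact: (H n (leqnn n) x K1x y K2y).
Qed.

Lemma integral_itv_cat (g : R -> \bar R) (a b c : R) :
  measurable_fun setT g -> (forall x, 0 <= g x) -> (a <= b)%R -> (b <= c)%R ->
  \int[mu]_(x in `[a, c]) g x <=
  \int[mu]_(x in `[a, b]) g x + \int[mu]_(x in `[b, c]) g x.
Proof.
move=> mg g0 ab bc.
rewrite (_ : [set` `[a, c]] = [set` `[a, b]] `|` [set` `]b, c]]); last first.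
  apply/seteqP; split => x /=; rewrite !in_itv/=.
    by case: (leP x b) => _ /andP[-> ->]; [left|right].
  case=> /andP[ax xb]; first by rewrite ax (le_trans xb).
  by rewrite xb andbT (le_trans ab)// ltW.
rewrite ge0_integral_setU//=.
- rewrite leeD2l//; apply: ge0_subset_integral => //.
    exact: measurable_funTS.
  by apply: subset_itvr; rewrite bnd_simp.
- exact: measurable_funTS.
- apply/disj_setPS => x [/=]; rewrite !in_itv/= => /andP[_ xb] /andP[bx _].
  by rewrite leNgt bx in xb.
Qed.

Lemma dist_itv_le (a b x y : R) :
  x \in `[a, b] -> y \in `[a, b] -> (`|x - y| <= b - a)%R.
Proof.
by rewrite !in_itv/= ler_norml => /andP[? ?] /andP[? ?]; lra.
Qed.

(** Finite end values of [phi] let the increments telescope, and the bound [k] turns the small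
    measure of what [K1] and [K2] miss into a small integral. *)
Lemma dominates_max_bounded phi g1 g2 (k : R) :
  phi 0%R \is a fin_num -> phi 1%R \is a fin_num ->
  (forall x y, (0 <= x)%R -> (x <= y)%R -> (y <= 1)%R -> phi x <= phi y) ->
  measurable_fun setT g1 -> measurable_fun setT g2 ->
  (forall x, 0 <= g1 x <= k%:E) -> (forall x, 0 <= g2 x <= k%:E) ->
  dominates_on_rational_itv phi g1 -> dominates_on_rational_itv phi g2 ->
  \int[mu]_(x in `[0%R, 1%R]) maxe (g1 x) (g2 x) <= phi 1%R - phi 0%R.
Proof.
move=> phi0 phi1 ndphi mg1 mg2 g1k g2k dom1 dom2.
have k0 : (0 <= k)%R.
  by rewrite -lee_fin; case/andP: (g1k 0%R); exact: le_trans.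
pose I : set (measurableTypeR R) := `[0%R, 1%R]%classic.
have mI : measurable I by exact: measurable_itv.
have muI : mu I = 1.
  by rewrite /I lebesgue_measure_itv/= lte_fin ltr01 oppr0 adde0.
pose p x := fine (phi x).
have phiE x : (0 <= x)%R -> (x <= 1)%R -> phi x = (p x)%:E.
  move=> x0 x1; rewrite /p fineK// fin_numElt.
  rewrite (lt_le_trans _ (ndphi 0%R x (lexx _) x0 x1)); last first.
    by move: phi0; rewrite fin_numElt => /andP[].
  rewrite (le_lt_trans (ndphi x 1%R x0 x1 (lexx _)))//.
  by move: phi1; rewrite fin_numElt => /andP[].
have g1_ge0 x : 0 <= g1 x by case/andP: (g1k x).
have g2_ge0 x : 0 <= g2 x by case/andP: (g2k x).
pose E1 := I `&` [set x | g2 x <= g1 x].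
pose E2 := I `\` E1.
have mE1 : measurable E1.
  by apply: measurable_lee => //; exact: measurable_funTS.
have mE2 : measurable E2 by exact: measurableD.
have fin_sub E : measurable E -> E `<=` I -> mu E < +oo.
  move=> mE EI; apply: (@le_lt_trans _ _ (mu I)); last by rewrite muI ltry.
  by apply: le_measure; rewrite ?inE.
apply/lee_addgt0Pr => e e0.
(* The part missed by [K1] and [K2] has measure at most [2 e'] and contributes at most
   [2 k e' = e k / (k + 1) <= e]; the [+ 1] covers [k = 0]. *)
pose e' : R := (e / (2 * (k + 1)))%R.
have e'0 : (0 < e')%R by rewrite divr_gt0// mulr_gt0// ltr_wpDl.
have [K1 [cK1 K1E muK1]] :=
  lebesgue_regularity_inner mE1 (fin_sub _ mE1 (@subIsetl _ _ _)) e'0.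
have [K2 [cK2 K2E muK2]] :=
  lebesgue_regularity_inner mE2 (fin_sub _ mE2 (@subDsetl _ _ _)) e'0.
have mK1 : measurable (K1 : set (measurableTypeR R)) by exact: compact_measurable.
have mK2 : measurable (K2 : set (measurableTypeR R)) by exact: compact_measurable.
have K12 : K1 `&` K2 = set0.
  by rewrite -subset0 => x [/K1E E1x /K2E [_]]; apply.
have [N sepN] := compact_separation cK1 cK2 K12.
pose u x := if x \in K1 then g1 x else if x \in K2 then g2 x else 0.
have u0 x : 0 <= u x by rewrite /u; case: ifP => // _; case: ifP.
have mu_ : measurable_fun (setT : set (measurableTypeR R)) u.
  apply: measurable_fun_ifT => //; last apply: measurable_fun_ifT => //.
    by apply: (measurable_fun_bool true); rewrite setTI preimage_mem_true.
  by apply: (measurable_fun_bool true); rewrite setTI preimage_mem_true.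
(* The nodes are rational, so the domination hypotheses apply on each cell, and the mesh is the
   separation bound of [K1] and [K2]. *)
pose q j : R := (j%:R / N.+1%:R)%R.
have qE j : q j = ratr (j%:R / N.+1%:R)%R by rewrite fmorph_div/= !ratr_nat.
have q_ge0 j : (0 <= q j)%R by rewrite divr_ge0.
have qS j : (q j <= q j.+1)%R by rewrite ler_pM2r ?invr_gt0// ler_nat.
have qSB j : (q j.+1 - q j = N.+1%:R^-1)%R.
  by rewrite /q -mulrBl -natr1 addrAC subrr add0r mul1r.
have q_le1 j : (j <= N.+1)%N -> (q j <= 1)%R.
  by move=> jN; rewrite ler_pdivrMr// mul1r ler_nat.
have step j : (j < N.+1)%N ->
    \int[mu]_(x in `[q j, q j.+1]) u x <= (p (q j.+1) - p (q j))%:E.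
  move=> jN.
  have dom g : dominates_on_rational_itv phi g ->
      \int[mu]_(x in `[q j, q j.+1]) g x <= (p (q j.+1) - p (q j))%:E.
    move=> /(_ (j%:R / N.+1%:R)%R (j.+1%:R / N.+1%:R)%R).
    rewrite -!qE phiE ?q_le1// phiE ?q_le1 ?(ltnW jN)//=; apply.
    - by rewrite divr_ge0.
    - by rewrite ltr_pM2r ?invr_gt0// ltr_nat.
    - by rewrite ler_pdivrMr// mul1r ler_nat.
  (* A cell that meets [K1] contains no point of [K2], so [u <= g1] on it; on a cell that misses
     [K1], [u <= g2]. *)
  have [[z [zI K1z]]|nK1] := pselect ([set` `[q j, q j.+1]] `&` K1 !=set0).
    apply: le_trans (dom _ dom1); apply: ge0_le_integral => //.
    + exact: measurable_funTS.
    + exact: measurable_funTS.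
    move=> x xI; rewrite /u; case: ifP => // _; case: ifPn => // /[!inE] K2x.
    have := sepN _ _ K1z K2x; rewrite ltNge -(qSB j).
    by rewrite dist_itv_le.
  apply: le_trans (dom _ dom2); apply: ge0_le_integral => //.
  + exact: measurable_funTS.
  + exact: measurable_funTS.
  move=> x xI; rewrite /u; case: ifPn => [/[!inE] K1x|_]; last by case: ifP.
  by exfalso; apply: nK1; exists x.
have intu j : (j <= N.+1)%N ->
    \int[mu]_(x in `[0%R, q j]) u x <= (p (q j) - p 0%R)%:E.
  elim: j => [_|j IH jN].
    by rewrite /q mul0r set_itv1 integral_set1 subrr.
  apply: (le_trans (integral_itv_cat mu_ u0 (q_ge0 j) (qS j))).
  rewrite (_ : p (q j.+1) - p 0 = (p (q j) - p 0) + (p (q j.+1) - p (q j)))%R.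
    by rewrite EFinD leeD// ?IH ?step// ltnW.
  by ring.
have q1 : q N.+1 = 1%R by rewrite /q divff// pnatr_eq0.
have {intu} := intu N.+1 (leqnn _); rewrite q1 => intu.
pose W := (E1 `\` K1) `|` (E2 `\` K2).
have mW : measurable W by apply: measurableU; exact: measurableD.
have muW : mu W <= (e' + e')%:E.
  rewrite EFinD; apply: le_trans (leeD (ltW muK1) (ltW muK2)).
  by apply: measureU2; exact: measurableD.
have -> : phi 1%R - phi 0%R = (p 1 - p 0)%R%:E by rewrite !phiE.
have : \int[mu]_(x in I) maxe (g1 x) (g2 x) <=
    \int[mu]_(x in I) (u x + k%:E * (\1_W x)%:E).
  apply: ge0_le_integral => //.
  - by move=> x _; rewrite le_max g1_ge0.
  - by apply: measurable_maxe; exact: measurable_funTS.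
  - apply: emeasurable_funD; first exact: measurable_funTS.
    apply: measurable_funeM; apply/measurable_EFinP.
    exact: measurable_indic.
  move=> x Ix.
  have mk : maxe (g1 x) (g2 x) <= k%:E.
    by rewrite ge_max; case/andP: (g1k x) => _ ->; case/andP: (g2k x).
  have k10 : 0 <= k%:E * (\1_W x)%:E by rewrite mule_ge0 ?lee_fin.
  have [K1x|K1x] := pselect (K1 x).
    apply: (@le_trans _ _ (u x)); last by rewrite leeDl.
    have [_ /= g21] := K1E _ K1x.
    by rewrite /u mem_set// ge_max lexx.
  have [K2x|K2x] := pselect (K2 x).
    apply: (@le_trans _ _ (u x)); last by rewrite leeDl.
    have [_ /= nE1] := K2E _ K2x.
    rewrite /u memNset// mem_set// ge_max lexx andbT leNgt; apply/negP => g21.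
    by apply: nE1; split => //=; exact: ltW.
  have Wx : W x.
    have [E1x|E1x] := pselect (E1 x); first by left.
    by right.
  by rewrite indicE mem_set// mule1 (le_trans mk)// leeDr.
move=> /le_trans; apply.
rewrite ge0_integralD//; last 3 first.
- exact: measurable_funTS.
- by move=> x _; rewrite mule_ge0 ?lee_fin.
- by apply: measurable_funeM; apply/measurable_EFinP; exact: measurable_indic.
rewrite leeD// ge0_integralZl//; last first.
  by apply/measurable_EFinP; exact: measurable_indic.
rewrite integral_indic//.
apply: (@le_trans _ _ (k%:E * (e' + e')%:E)).
  rewrite lee_wpmul2l ?lee_fin//; apply: le_trans muW.
  by apply: le_measure; rewrite ?inE//; exact: measurableI.
rewrite -EFinM lee_fin /e'.
have -> : (k * (e / (2 * (k + 1)) + e / (2 * (k + 1))) = e * (k / (k + 1)))%R.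
  by field; rewrite gt_eqF// ltr_wpDl.
by rewrite ger_pMr// ler_pdivrMr ?mul1r ?lerDl ?ltr_wpDl.
Qed.

(** An infinite end value of [phi] makes the right-hand side [+oo]. Otherwise truncate both
    functions at [n], which preserves domination, apply the bounded case and pass to the limit by
    monotone convergence. *)
Lemma dominates_max phi g1 g2 :
  (forall x y, (0 <= x)%R -> (x <= y)%R -> (y <= 1)%R -> phi x <= phi y) ->
  measurable_fun setT g1 -> measurable_fun setT g2 ->
  (forall x, 0 <= g1 x) -> (forall x, 0 <= g2 x) ->
  dominates_on_rational_itv phi g1 -> dominates_on_rational_itv phi g2 ->
  \int[mu]_(x in `[0%R, 1%R]) maxe (g1 x) (g2 x) <= subel (phi 1%R) (phi 0%R).
Proof.
move=> ndphi mg1 mg2 g10 g20 dom1 dom2.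
have phi01 := ndphi 0%R 1%R (lexx _) ler01 (lexx _).
have [phi0|phi0] := boolP (phi 0%R \is a fin_num); last first.
  suff -> : subel (phi 1%R) (phi 0%R) = +oo by rewrite leey.
  move: phi01 phi0; case: (phi 0%R) => [//| |] ; case: (phi 1%R) => //.
have [phi1|phi1] := boolP (phi 1%R \is a fin_num); last first.
  suff -> : subel (phi 1%R) (phi 0%R) = +oo by rewrite leey.
  by move: phi01 phi1 phi0; case: (phi 1%R) => //; case: (phi 0%R).
have -> : subel (phi 1%R) (phi 0%R) = phi 1%R - phi 0%R.
  by move: phi1; case: (phi 1%R).
have -> : \int[mu]_(x in `[0%R, 1%R]) maxe (g1 x) (g2 x) =
    \int[mu]_(x in `[0%R, 1%R]) ereal_sup (range (fun n : nat =>
      maxe (mine (g1 x) n%:R%:E) (mine (g2 x) n%:R%:E))).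
  apply: eq_integral => x _; rewrite -[LHS]ereal_sup_mine ?le_max ?g10//.
  by congr ereal_sup; apply: eq_imagel => n _; rewrite min_maxl.
have dom_min g n : measurable_fun setT g -> (forall x, 0 <= g x) ->
    dominates_on_rational_itv phi g ->
    dominates_on_rational_itv phi (fun x => mine (g x) n%:R%:E).
  move=> mg g0 dom s t s0 st t1; apply: le_trans (dom s t s0 st t1).
  apply: ge0_le_integral => //.
  - by move=> x _; rewrite le_min g0 lee_fin/=.
  - by apply: measurable_mine => //; exact: measurable_funTS.
  - exact: measurable_funTS.
  - by move=> x _; rewrite ge_min lexx.
apply: integral_ereal_sup_le => //.
- move=> n; apply: measurable_maxe; apply: measurable_mine => //;
    exact: measurable_funTS.
- by move=> n x _; rewrite le_max le_min g10 lee_fin ler0n.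
- move=> x _ i j ij.
  have ijR : (i%:R%:E <= j%:R%:E :> \bar R) by rewrite lee_fin ler_nat.
  rewrite ge_max; apply/andP; split; rewrite le_max; apply/orP; [left|right];
    by rewrite le_min !ge_min lexx/= ijR orbT.
- move=> n; apply: (@dominates_max_bounded _ _ _ n%:R) => //.
  + by apply: measurable_mine.
  + by apply: measurable_mine.
  + by move=> x; rewrite le_min g10 lee_fin ge_min lexx orbT ler0n.
  + by move=> x; rewrite le_min g20 lee_fin ge_min lexx orbT ler0n.
  + exact: dom_min.
  + exact: dom_min.
Qed.

End superadditive_increments.

(** * Left-continuous curves *)

Lemma metrizes_real (R : realType) : metrizes (fun x y : R => `|x - y|%R).
Proof.
split.
- by move=> x y; exact: normr_ge0.
- by move=> x y; split=> [/normr0_eq0/subr0_eq//|->]; rewrite subrr normr0.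
- by move=> x y; rewrite distrC.
- by move=> x y z; exact: ler_distD.
- move=> A; rewrite openE; split=> [Ao x Ax|H x Ax].
    have /nbhs_ballP[e /= e0 xe] := Ao _ Ax.
    by exists e => // y /= xy; exact: xe.
  by have [e e0 xe] := H _ Ax; apply/nbhs_ballP; exists e.
Qed.

Lemma at_left_exists_rat (R : realType) (t : R) (A : set R) :
  (\forall s \near t^'-, A s) ->
  exists2 q : rat, (ratr q < t)%R & forall s, (ratr q < s < t)%R -> A s.
Proof.
move=> /nbhs_ballP[e /= e0 H].
have /rat_in_itvoo[q] : (t - e < t)%R by rewrite gtrBl.
rewrite in_itv/= => /andP[eq qt]; exists q => // s /andP[qs st].
apply: H => //=; rewrite /ball/= ger0_norm ?subr_ge0 ?ltW//.
by rewrite ltrBlDr -ltrBlDl (lt_trans eq).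
Qed.

Section metric.
Context {R : realType} {M : ptopologicalType} (d : M -> M -> R).
Hypothesis dM : metrizes d.

Lemma dist_refl x : d x x = 0%R.
Proof. exact/(metrizes_eq0 dM). Qed.

Lemma dist_ball_open x e : open [set y | (d x y < e)%R].
Proof.
apply/(metrizes_open dM) => y /= xy; exists (e - d x y)%R.
  by rewrite subr_gt0.
move=> z /=; rewrite ltrBrDl => /(le_lt_trans _); apply.
exact: metrizes_triangle dM _ _ _.
Qed.

Definition left_continuous_fun (u : R -> M) :=
  forall t, u s @[s --> t^'-] --> u t.

Lemma left_continuous_dist (u : R -> M) (t e : R) :
  left_continuous_fun u -> (0 < e)%R ->
  exists2 q : rat, (ratr q < t)%R &
    forall s, (ratr q < s <= t)%R -> (d (u t) (u s) < e)%R.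
Proof.
move=> ucont e0.
have /ucont /at_left_exists_rat[q qt H] : nbhs (u t) [set y | (d (u t) y < e)%R].
  by apply: open_nbhs_nbhs; split; [exact: dist_ball_open|rewrite /= dist_refl].
exists q => // s; rewrite le_eqVlt andb_orr => /orP[/andP[_ /eqP ->]|/H//].
by rewrite dist_refl.
Qed.

(** Inner approximations of [A] with a uniform margin: a limit of points of [shrink A n] lies in
    [A]. *)
Definition shrink (A : set M) (n : nat) : set M :=
  [set x | forall y, (d x y < n.+1%:R^-1)%R -> A y].

(** Membership of [u t] in an open set is read off from times strictly before [t]: left continuity
    transfers it back and forth, with a margin [1/(n+1)] to spare. The bound [a] keeps the rational
    [q] inside a prescribed range of times. *)
Lemma open_left_limitP (u : R -> M) (A : set M) (t a : R) :
  left_continuous_fun u -> open A -> (a < t)%R ->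
  A (u t) <-> exists (n : nat) (q : rat), (a <= ratr q < t)%R /\
    forall r, (ratr q < r < t)%R -> shrink A n (u r).
Proof.
move=> ucont Ao at_; split.
  move=> Aut; have [e e0 He] := (metrizes_open dM A).1 Ao _ Aut.
  have e20 : (0 < e / 2)%R by rewrite divr_gt0.
  have [n _ /(_ n (leqnn n))/= ne] := near_infty_natSinv_lt (PosNum e20).
  have [q qt Hq] := left_continuous_dist t ucont e20.
  have /rat_in_itvoo[q'] : (Num.max a (ratr q) < t)%R by rewrite gt_max at_ qt.
  rewrite in_itv/= gt_max => /andP[/andP[aq' qq'] q't].
  exists n, q'; split; first by rewrite ltW.
  move=> r /andP[q'r rt] y ry; apply: He => /=.
  rewrite (le_lt_trans (metrizes_triangle dM _ (u r) _))// [ltRHS](splitr e).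
  rewrite ltrD//; last exact: lt_trans ne.
  by apply: Hq; rewrite (lt_trans qq')// ltW.
move=> [n [q [/andP[aq qt] Hq]]].
have n0 : (0 < n.+1%:R^-1 :> R)%R by rewrite invr_gt0.
have [q' q't Hq'] := left_continuous_dist t ucont n0.
have /rat_in_itvoo[r] : (Num.max (ratr q') (ratr q) < t :> R)%R.
  by rewrite gt_max q't qt.
rewrite in_itv/= gt_max => /andP[/andP[q'r qr] rt].
apply: (Hq (ratr r)); first by rewrite qr.
by rewrite (metrizes_sym dM) Hq'// q'r ltW.
Qed.

(** By the previous characterization the preimage is a countable union of sets [J n q]. Each is an
    interval, because its condition on [t > q] only gets weaker as [t] decreases. *)
Lemma measurable_left_continuous_preimage (u : R -> M) (A : set M) :
  left_continuous_fun u -> open A ->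
  measurable (u @^-1` A : set (measurableTypeR R)).
Proof.
move=> ucont Ao.
pose J (n : nat) (q : rat) : set (measurableTypeR R) := [set t | (ratr q < t)%R /\
  forall r, (ratr q < r < t)%R -> shrink A n (u r)].
rewrite (_ : u @^-1` A = \bigcup_n \bigcup_q J n q).
  apply: bigcupT_measurable => n; apply: bigcupT_measurable_rat => q.
  apply: is_interval_measurable => s t [qs Hs] [qt Ht] r /andP[sr rt].
  split; first exact: lt_le_trans sr.
  by move=> r' /andP[qr' r'r]; apply: Ht; rewrite qr'/= (lt_le_trans r'r).
apply/seteqP; split=> t /=.
  have t1 : (t - 1 < t)%R by rewrite gtrBl.
  move=> /(open_left_limitP ucont Ao t1).1[n [q [/andP[_ qt] H]]].
  by exists n => //; exists q.
move=> [n _ [q _ [qt H]]].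
apply/(open_left_limitP ucont Ao qt); exists n, q; split => //.
by rewrite lexx.
Qed.

Lemma measurable_left_continuous (u : R -> M) : left_continuous_fun u ->
  measurable_fun setT (u : measurableTypeR R -> borel M).
Proof.
move=> ucont; apply: (@measurability _ _ (measurableTypeR R) (borel M) setT u
  (@open M) erefl).
move=> _ [A Ao <-]; rewrite setTI.
exact: measurable_left_continuous_preimage.
Qed.

End metric.

Lemma measurable_left_continuous_real (R : realType) (u : R -> R) :
  left_continuous_fun u -> measurable_fun setT u.
Proof.
move=> ucont; apply: (measurability _ (RGenOpens.measurableE R)) => //.
move=> _ [_ [a [b ->]] <-]; rewrite setTI.
apply: (measurable_left_continuous_preimage (@metrizes_real R)) => //.
Qed.

Lemma separable_dense_seq (M : ptopologicalType) : separable M ->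
  exists u : nat -> M, forall A, open A -> A !=set0 -> exists n, A (u n).
Proof.
move=> [S cS dS].
have [x0 [_ Sx0]] : [set: M] `&` S !=set0 by apply: dS; [exists point|exact: openT].
have /pfcard_geP[S0|[f]] : (S #<= [set: nat])%card by [].
  by move: Sx0; rewrite S0.
exists f => A Ao A0; have [x [Ax Sx]] := dS _ A0 Ao.
have [n _ fn] : [set f n | n in [set: nat]] x by exact: (@surj _ _ _ _ f).
by exists n; rewrite fn.
Qed.

(** The balls of radius [1/(k+1)] around a dense sequence that have finite measure cover the space,
    since every point has such a ball inside a neighbourhood of finite measure. Balls of infinite
    measure are replaced by the empty set. *)
Lemma locally_finite_sigma_finite (R : realType) (M : ptopologicalType)
    (d : M -> M -> R) (m : {measure set (borel M) -> \bar R}) :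
  metrizes d -> separable M ->
  (forall x : M, exists U : set M, [/\ open U, U x & m U < +oo]) ->
  sigma_finite setT m.
Proof.
move=> dM /separable_dense_seq[u uD] lf.
pose B (n k : nat) : set M := [set y | (d (u n) y < k.+1%:R^-1)%R].
pose F j : set (borel M) := if (unpickle j : option (nat * nat)) is Some (n, k)
  then if m (B n k) < +oo then B n k else set0 else set0.
exists F; last first.
  move=> j; rewrite /F; case: unpickle => [[n k]|]; last first.
    by rewrite measure0; split => //; exact: ltry.
  case: ifPn => [Boo|_]; last by rewrite measure0; split => //; exact: ltry.
  by split => //; apply: sub_sigma_algebra; exact: dist_ball_open.
apply/seteqP; split => // x _.
have [U [Uo Ux mU]] := lf x.
have [e e0 He] := (metrizes_open dM U).1 Uo _ Ux.
have e20 : (0 < e / 2)%R by rewrite divr_gt0.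
have [k _ /(_ k (leqnn k))/= ke] := near_infty_natSinv_lt (PosNum e20).
have [|n /= xn] := uD _ (dist_ball_open dM x (k.+1%:R^-1)%R).
  by exists x; rewrite /= dist_refl// invr_gt0.
have BU : B n k `<=` U.
  move=> y /= ny; apply: He => /=.
  rewrite (le_lt_trans (metrizes_triangle dM _ (u n) _))// [ltRHS](splitr e).
  by rewrite ltrD// (lt_trans _ ke).
have mB : m (B n k) < +oo.
  apply: le_lt_trans mU; apply: le_measure => //; rewrite inE.
    by apply: sub_sigma_algebra; exact: dist_ball_open.
  exact: sub_sigma_algebra.
exists (pickle (n, k)); first exact: Logic.I.
by rewrite /F pickleK mB /B /= (metrizes_sym dM).
Qed.

(** * The distance between curves and the measurability of evaluations *)

Section curves.
Context {R : realType} {M : ptopologicalType} (l : time_separation R M)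
  (d : M -> M -> R).
Hypothesis dM : metrizes d.
Local Notation mu := (@lebesgue_measure R).
Implicit Types c : LCC l.

Lemma val_insubd_unit (t : R) : (0 <= t <= 1)%R ->
  val (insubd (@unit_interval0 R) t) = t.
Proof. by move=> t01; rewrite val_insubd t01. Qed.

Lemma at_time_outside (c : @unit_interval R -> M) (t : R) :
  ~~ (0 <= t <= 1)%R -> at_time c t = at_time c 0%R.
Proof.
move=> t01; rewrite /at_time; congr c; apply: val_inj.
by rewrite !val_insubd (negbTE t01) lexx ler01.
Qed.

(** The junk value outside [[0, 1]] is harmless: the extension is constant up to time 0 and again
    after time 1, and the jump it may have at 1 is on the right. *)
Lemma eval_left_continuous c : left_continuous_fun (fun t => at_time c t).
Proof.
move=> t; have [t0|t0] := leP t 0%R.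
  have tE : at_time c t = at_time c 0%R.
    move: t0; rewrite le_eqVlt => /predU1P[->//|t0].
    by rewrite at_time_outside// leNgt t0.
  apply: cvg_near_cst; rewrite tE; near=> s.
  rewrite at_time_outside// leNgt.
  have : (s < t)%R by near: s; exact: nbhs_left_lt.
  by move=> st; rewrite (lt_le_trans st t0).
have [t1|t1] := leP t 1%R.
  by apply: curve_left_continuous; rewrite t0.
apply: cvg_near_cst; rewrite (@at_time_outside c t) ?negb_and -?ltNge ?t1 ?orbT//.
near=> s; apply: at_time_outside; rewrite negb_and -!ltNge.
apply/orP; right; near: s; exact: nbhs_left_gt.
Unshelve. all: by end_near. Qed.

Lemma causal_le_eval c (s t : R) : (0 <= s)%R -> (s <= t)%R -> (t <= 1)%R ->
  causal_le l (eval s c) (eval t c).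
Proof.
move=> s0 st t1; apply: curve_causal.
by rewrite !val_insubd_unit ?(le_trans s0)//= ?t1 ?s0 ?(le_trans st).
Qed.

Lemma measurable_curve c :
  measurable_fun setT ((fun t => eval t c) : measurableTypeR R -> borel M).
Proof. by apply: (measurable_left_continuous dM); exact: eval_left_continuous. Qed.

Lemma dist_sub_le x y x' y' : (`|d x y - d x' y'| <= d x x' + d y y')%R.
Proof.
have := metrizes_triangle dM x x' y; have := metrizes_triangle dM x' y' y.
have := metrizes_triangle dM x' x y'; have := metrizes_triangle dM x y y'.
rewrite (metrizes_sym dM x' x) (metrizes_sym dM y' y) ler_norml; lra.
Qed.

Lemma measurable_dist_curve c c' :
  measurable_fun setT (fun t : R => d (eval t c) (eval t c')).
Proof.
apply: measurable_left_continuous_real => t.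
apply/cvgrPdist_lt => e e0.
have e20 : (0 < e / 2)%R by rewrite divr_gt0.
have [q qt Hq] := left_continuous_dist dM t (@eval_left_continuous c) e20.
have [q' q't Hq'] := left_continuous_dist dM t (@eval_left_continuous c') e20.
near=> s; rewrite (le_lt_trans (dist_sub_le _ _ _ _))// [ltRHS](splitr e).
have st : (s <= t)%R by apply: ltW; near: s; exact: nbhs_left_lt.
rewrite ltrD//.
  by apply: Hq; rewrite st andbT; near: s; exact: nbhs_left_gt.
by apply: Hq'; rewrite st andbT; near: s; exact: nbhs_left_gt.
Unshelve. all: by end_near. Qed.

Lemma measurable_EFin_dist_curve c c' (D : set (measurableTypeR R)) :
  measurable_fun D (fun t : R => (d (eval t c) (eval t c'))%:E).
Proof.
apply/measurable_EFinP; apply: measurable_funTS; exact: measurable_dist_curve.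
Qed.

Lemma dist_le_LCC_dist c c' (D : set (measurableTypeR R)) :
  measurable D -> D `<=` `[0%R, 1%R] ->
  \int[mu]_(t in D) (d (eval t c) (eval t c'))%:E <= LCC_dist d c c'.
Proof.
move=> mD D01; apply: (@le_trans _ _ (\int[mu]_(t in `[0%R, 1%R])
    (d (eval t c) (eval t c'))%:E)).
  apply: ge0_subset_integral => //; first exact: measurable_EFin_dist_curve.
  by move=> t _; rewrite lee_fin metrizes_ge0.
by rewrite leeDr// lee_fin metrizes_ge0.
Qed.

Lemma dist0_le_LCC_dist c c' : (d (eval 0 c) (eval 0 c'))%:E <= LCC_dist d c c'.
Proof.
rewrite leeDl//; apply: integral_ge0 => t _.
by rewrite lee_fin metrizes_ge0.
Qed.

Lemma LCC_dist_refl c : LCC_dist d c c = 0.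
Proof.
rewrite /LCC_dist dist_refl// add0e integral0_eq// => t _.
by rewrite dist_refl.
Qed.

Lemma LCC_dist_triangle c1 c2 c3 :
  LCC_dist d c1 c3 <= LCC_dist d c1 c2 + LCC_dist d c2 c3.
Proof.
rewrite /LCC_dist addeACA leeD//.
  by rewrite -EFinD lee_fin; exact: metrizes_triangle.
rewrite -ge0_integralD//; do ?exact: measurable_EFin_dist_curve.
  apply: ge0_le_integral => //; do ?exact: measurable_EFin_dist_curve.
  - by move=> t _; rewrite lee_fin metrizes_ge0.
  - by apply: emeasurable_funD; exact: measurable_EFin_dist_curve.
  - by move=> t _; rewrite -EFinD lee_fin; exact: metrizes_triangle.
- by move=> t _; rewrite lee_fin metrizes_ge0.
- by move=> t _; rewrite lee_fin metrizes_ge0.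
Qed.

(** At time 0 the distance controls the evaluation, which is continuous. At [t > 0] it only controls
    time averages; but staying in [shrink d A n] during [(q, t)] is a closed condition on the curve,
    and the preimage of [A] is a countable union of such conditions. *)
Lemma measurable_eval (t : R) : (0 <= t <= 1)%R ->
  measurable_fun setT (eval t : borel_LCC l d -> borel M).
Proof.
move=> /andP[]; rewrite le_eqVlt => /predU1P[<- _|t0 t1].
  apply: (@measurability _ _ (borel_LCC l d) (borel M) setT _ (@open M) erefl).
  move=> _ [A Ao <-]; rewrite setTI; apply: sub_sigma_algebra => c /= Ac.
  have [e e0 He] := (metrizes_open dM A).1 Ao _ Ac.
  exists e => // c' cc'; apply: He => /=; rewrite -lte_fin.
  exact: le_lt_trans (dist0_le_LCC_dist _ _) cc'.
apply: (@measurability _ _ (borel_LCC l d) (borel M) setT _ (@open M) erefl).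
move=> _ [A Ao <-]; rewrite setTI.
pose V (n : nat) (q : rat) : set (borel_LCC l d) := [set c : LCC l |
  forall r, (ratr q < r < t)%R -> shrink d A n (eval r c)].
(* Keeping [q] in [[0, t)] places the interval [(q, t)] inside [[0, 1]], where the distance
   integrates. *)
have VE : (eval t @^-1` A : set (borel_LCC l d)) = \bigcup_n \bigcup_(q : rat)
    (if (0 <= (ratr q : R) < t)%R then V n q else set0).
  apply/seteqP; split=> c /=.
    move=> /(open_left_limitP dM (@eval_left_continuous c) Ao t0).1[n [q [qt H]]].
    by exists n => //; exists q => //; rewrite qt.
  move=> [n _ [q _]]; case: ifPn => // qt H.
  by apply/(open_left_limitP dM (@eval_left_continuous c) Ao t0); exists n, q.
rewrite VE; apply: bigcupT_measurable => n; apply: bigcupT_measurable_rat => q.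
case: ifPn => // /andP[q0 qt].
rewrite -[V n q]setCK; apply: measurableC; apply: sub_sigma_algebra => c.
move=> /existsNP[r /not_implyP[/andP[qr rt]]].
move=> /existsNP[y /not_implyP[ry nAy]].
(* Half of the slack in [d (eval r c) y < 1/(n+1)]: one half pays for moving along [c] from time [r]
   to an earlier [s], the other for moving from [c] to [c'] at time [s]. *)
pose e := ((n.+1%:R^-1 - d (eval r c) y) / 2)%R.
have e0 : (0 < e)%R by rewrite divr_gt0// subr_gt0.
have [q' q'r Hq'] := left_continuous_dist dM r (@eval_left_continuous c) e0.
pose a : R := Num.max (ratr q) (ratr q').
have ar : (a < r)%R by rewrite gt_max qr q'r.
(* A curve closer than [e (r - a)] to [c] in the integral distance must be [e]-close to it at some
   time of [(a, r)]. *)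
exists (e * (r - a))%R; first by rewrite mulr_gt0// subr_gt0.
move=> c' cc' Vc'.
have [s [as_ sr] cs] : exists2 s, (a < s)%R /\ (s < r)%R &
    (d (eval s c) (eval s c') < e)%R.
  apply: contrapT => nex; move: cc'; apply/negP; rewrite -leNgt.
  apply: (@le_trans _ _ (\int[mu]_(s in `]a, r[) (d (eval s c) (eval s c'))%:E)).
    rewrite (_ : (e * (r - a))%:E = e%:E * mu `]a, r[).
      rewrite -integral_cst//; apply: ge0_le_integral => //.
      - by move=> s _; rewrite lee_fin ltW.
      - exact: measurable_EFin_dist_curve.
      - move=> s; rewrite /= in_itv/= => /andP[as_ sr]; rewrite lee_fin leNgt.
        by apply/negP => cs; apply: nex; exists s.
    by rewrite lebesgue_measure_itv/= lte_fin ar -EFinB -EFinM.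
  apply: dist_le_LCC_dist => // s; rewrite /= !in_itv/= => /andP[as_ sr].
  rewrite (le_trans q0) ?(le_trans _ (ltW as_)) ?le_max ?lexx//=.
  by rewrite (le_trans (ltW sr))// (le_trans (ltW rt)).
apply: nAy; apply: (Vc' s).
  rewrite (lt_trans sr rt) andbT (le_lt_trans _ as_)// le_max lexx//.
have rs : (d (eval r c) (eval s c) < e)%R.
  by apply: Hq'; rewrite (ltW sr) andbT (le_lt_trans _ as_)// le_max lexx orbT.
have tri1 := metrizes_triangle dM (eval s c') (eval s c) y.
have tri2 := metrizes_triangle dM (eval s c) (eval r c) y.
rewrite (metrizes_sym dM (eval s c') (eval s c)) in tri1.
rewrite (metrizes_sym dM (eval s c) (eval r c)) in tri2.
have aux (x1 x2 x3 x4 x5 N : R) : (x1 < (N - x5) / 2 -> x2 < (N - x5) / 2 ->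
  x3 <= x1 + x4 -> x4 <= x2 + x5 -> x3 < N)%R by lra.
exact: aux cs rs tri1 tri2.
Qed.

End curves.

(** * Speed of a restricted curve *)

(** This is [+oo] times the Dirac mass at [x]: the constant map sends the whole line, of infinite
    Lebesgue measure, to [x]. *)
Definition infinite_atom (R : realType) (x : R) :
    {measure set (measurableTypeR R) -> \bar R} :=
  image_measure (@lebesgue_measure R)
    (@measurable_cst _ _ (measurableTypeR R) (measurableTypeR R) setT x).

Lemma infinite_atom_in (R : realType) (x : R) A : A x -> infinite_atom x A = +oo.
Proof.
move=> Ax; rewrite /infinite_atom /image_measure /= /pushforward.
rewrite (_ : _ @^-1` _ = [set` `]-oo, +oo[]); last first.
  by rewrite set_itvNyy; apply/seteqP; split.
by rewrite lebesgue_measure_itv.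
Qed.

Lemma infinite_atom_notin (R : realType) (x : R) A :
  ~ A x -> infinite_atom x A = 0.
Proof.
move=> Ax; rewrite /infinite_atom /image_measure /= /pushforward.
by rewrite (_ : _ @^-1` _ = set0) ?measure0//; apply/seteqP; split.
Qed.

(** The reverse triangle inequality, applied twice with nonnegative terms. The minimum over both
    orders of summation is harmless, since absorption on the left only matters for infinite
    summands, and here these can only be [+oo]. *)
Lemma causal_sep_mono (R : realType) (M : Type) (l : time_separation R M)
    (x y z w : M) :
  causal_le l x y -> causal_le l y z -> causal_le l z w -> l y z <= l x w.
Proof.
move=> xy yz zw.
have add_ge0 (a b : \bar R) : 0 <= a -> 0 <= b -> b <= addel a b /\ a <= addel a b.
  case: a => [a| |]//= a0 b0; last by rewrite leey.
  by rewrite leeDr// leeDl.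
have lxz : l y z <= l x z.
  apply: le_trans (tsep_triangle l x y z); rewrite le_min.
  by have [-> _] := add_ge0 _ _ xy yz; have [_ ->] := add_ge0 _ _ yz xy.
apply: (le_trans lxz); apply: le_trans (tsep_triangle l x z w).
have xz : 0 <= l x z by exact: le_trans lxz.
rewrite le_min.
by have [_ ->] := add_ge0 _ _ xz zw; have [-> _] := add_ge0 _ _ zw xz.
Qed.

Section speed.
Context {R : realType} {M : ptopologicalType} (l : time_separation R M).
Local Notation mu := (@lebesgue_measure R).
Implicit Types c : LCC l.

(** By maximality, each absolutely continuous part lies below the other's largest measure, hence
    below its absolutely continuous part. Equal integrals over all measurable sets identify the
    densities, the Lebesgue measure being sigma-finite. *)
Lemma causal_speed_unique c v w :
  is_causal_speed c v -> is_causal_speed c w -> {ae mu, forall t, v t = w t}.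
Proof.
have le v1 v2 : is_causal_speed c v1 -> is_causal_speed c v2 ->
    {ae mu, forall t, v1 t <= v2 t}.
  move=> [nu1 [na1 [[rnu1 _] [na1_dom na1_le _] [mv1 v1_0 na1E]]]].
  move=> [nu2 [na2 [[_ max2] [_ _ max_na2] [mv2 v2_0 na2E]]]].
  apply: ae_le_of_integrals_sigma_finite => //; first exact: sigma_finiteT.
  move=> A mA; rewrite -na1E// -na2E//; apply: max_na2 => // B mB.
  by apply: le_trans (na1_le _ mB) _; exact: max2.
move=> cv cw; apply: negligibleS (negligibleU (le v w cv cw) (le w v cw cv)).
move=> t /= vw; apply/not_andP => -[wv vw'].
by apply: vw; apply/eqP; rewrite eq_le wv.
Qed.

Lemma causal_speedP c v : is_causal_speed c v -> is_causal_speed c (causal_speed c).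
Proof.
by move=> cv; apply: (@xgetPex _ (cst 0) [set v | is_causal_speed c v]); exists v.
Qed.

Lemma causal_speed_none c :
  ~ (exists v, is_causal_speed c v) -> causal_speed c = cst 0.
Proof. by move=> nex; apply: xgetPN => v cv; apply: nex; exists v. Qed.

Lemma causal_speed_ge0 c t : 0 <= causal_speed c t.
Proof.
have [[v /causal_speedP[? [? [_ _ []]]]]//|/causal_speed_none ->] :=
  pselect (exists v, is_causal_speed c v).
by [].
Qed.

Lemma measurable_causal_speed c : measurable_fun setT (causal_speed c).
Proof.
have [[v /causal_speedP[? [? [_ _ []]]]]//|/causal_speed_none ->] :=
  pselect (exists v, is_causal_speed c v).
exact: measurable_cst.
Qed.

Section restriction.
Variables (s t : R).
Hypotheses (s0 : (0 <= s)%R) (st : (s < t)%R) (t1 : (t <= 1)%R).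
Let a : R := (t - s)%R.
Let a0 : (0 < a)%R. Proof. by rewrite subr_gt0. Qed.
Let T (r : measurableTypeR R) : measurableTypeR R := (a * r + s)%R.
Let T' (x : measurableTypeR R) : measurableTypeR R := (a^-1 * x + (- s / a))%R.
Let I : set (measurableTypeR R) := `]s, t[%classic.
Let J : set (measurableTypeR R) := `]0%R, 1%R[%classic.
Let mI : measurable I. Proof. exact: measurable_itv. Qed.
Let mJ : measurable J. Proof. exact: measurable_itv. Qed.

Let TK r : T' (T r) = r.
Proof.
suff aux (b x y : R) : b != 0%R -> (b^-1 * (b * x + y) + - y / b = x)%R.
  by apply: aux; exact: lt0r_neq0.
by move=> b0; field.
Qed.

Let T'K r : T (T' r) = r.
Proof.
suff aux (b x y : R) : b != 0%R -> (b * (b^-1 * x + - y / b) + y = x)%R.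
  by apply: aux; exact: lt0r_neq0.
by move=> b0; field.
Qed.

Let mT : measurable_fun setT T.
Proof. by apply: measurable_funD => //; exact: measurable_funM. Qed.

Let mT' : measurable_fun setT T'.
Proof. by apply: measurable_funD => //; exact: measurable_funM. Qed.

Let T_le x y : (T x <= T y)%R = (x <= y)%R.
Proof. by rewrite /T lerD2r ler_pM2l. Qed.

Let T_lt x y : (T x < T y)%R = (x < y)%R.
Proof. by rewrite /T ltrD2r ltr_pM2l. Qed.

Let T0 : T 0%R = s. Proof. by rewrite /T mulr0 add0r. Qed.
Let T1 : T 1%R = t. Proof. by rewrite /T mulr1 /a subrK. Qed.

Let TI r : I (T r) = J r.
Proof. by rewrite /I /J /= !in_itv/= -{1}T0 -T1 !T_lt. Qed.

Let T_ge0 r : (0 <= r)%R -> (0 <= T r)%R.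
Proof. by move=> r0; rewrite (le_trans s0)// -T0 T_le. Qed.

Let T_le1 r : (r <= 1)%R -> (T r <= 1)%R.
Proof. by move=> r1; rewrite (le_trans _ t1)// -T1 T_le. Qed.

Let subcurve_fun c : @unit_interval R -> M := fun r => at_time c (T (val r)).

Let at_time_subcurve c r : (0 <= r <= 1)%R ->
  at_time (subcurve_fun c) r = eval (T r) c.
Proof. by move=> r01; rewrite {1}/at_time /subcurve_fun val_insubd_unit. Qed.

Lemma subcurve_causal c : causal_curve l (subcurve_fun c).
Proof.
move=> x y xy; apply: causal_le_eval; last 2 first.
- by rewrite T_le.
- by apply: T_le1; case/andP: (valP y).
- by apply: T_ge0; case/andP: (valP x).
Qed.

Lemma subcurve_left_continuous c : left_continuous (subcurve_fun c).
Proof.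
move=> r /andP[r0 r1] A; rewrite at_time_subcurve ?(ltW r0)// => nA.
have /at_left_exists_rat[q qT H] := @eval_left_continuous _ _ _ c (T r) A nA.
have qr : (T' (ratr q) < r)%R by rewrite -T_lt T'K.
suff : \forall x \near r^'-, A (at_time (subcurve_fun c) x) by [].
near=> x.
have xr : (x < r)%R by near: x; exact: nbhs_left_lt.
have x0 : (0 < x)%R by near: x; exact: nbhs_left_gt.
have qx : (T' (ratr q) < x)%R by near: x; exact: nbhs_left_gt.
have : A (eval (T x) c) by apply: H; rewrite T_lt xr andbT -[ltLHS]T'K T_lt.
by rewrite -at_time_subcurve// (ltW x0) (le_trans (ltW xr)).
Unshelve. all: by end_near. Qed.

Definition subcurve c : LCC l :=
  MkLCC (@subcurve_causal c) (@subcurve_left_continuous c).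

Lemma eval_subcurve c r : (0 <= r <= 1)%R ->
  eval r (subcurve c) = eval ((t - s) * r + s) c.
Proof. by move=> r01; rewrite /eval /= at_time_subcurve. Qed.

Section transport.
Variables (c : LCC l) (nu nua : {measure set (measurableTypeR R) -> \bar R}).
Variable (v : R -> \bar R).
Hypothesis (nu_speed : speed_measure c nu).
Hypothesis (nua_ac : ac_part nu nua).
Hypothesis (v_density : Defs.lebesgue_density nua v).

(* The constraints [restricted_speed] only bear on open intervals: the
   endpoints 0 and 1 have infinite mass in the largest measure. *)
Let nus : {measure set (measurableTypeR R) -> \bar R} :=
  measure_add (image_measure (mrestr nu mI) mT')
  (measure_add (infinite_atom (0%R : R)) (infinite_atom (1%R : R))).

Let nusE A : nus A = nu (T' @^-1` A `&` I) +
  (infinite_atom (0%R : R) A + infinite_atom (1%R : R) A).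
Proof.
apply: (eq_trans (measure_addE _ _ _)); congr (_ + _).
exact: measure_addE.
Qed.

Let atoms0 (A : set R) : ~ A 0%R -> ~ A 1%R -> nus A = nu (T' @^-1` A `&` I).
Proof. by move=> A0 A1; rewrite nusE !infinite_atom_notin// !adde0. Qed.

Let mpre (f : measurableTypeR R -> measurableTypeR R) A :
  measurable_fun setT f -> measurable A -> measurable (f @^-1` A).
Proof. by move=> mf mA; rewrite -[X in measurable X]setTI; exact: mf. Qed.

Lemma subcurve_restricted_speed : restricted_speed (subcurve c) nus.
Proof.
split.
  rewrite atoms0; last 2 first.
  - by move=> /=; rewrite in_itv/= lexx ler01; apply.
  - by move=> /=; rewrite in_itv/= lexx ler01; apply.
  rewrite (_ : _ `&` _ = set0) ?measure0//; apply/seteqP; split => // x [/= nx Ix].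
  apply: nx; move: Ix; rewrite -{1}[x]T'K TI /J/= !in_itv/=.
  by move=> /andP[/ltW -> /ltW ->].
move=> x y x0 xy y1.
rewrite atoms0; last 2 first.
- by rewrite /= in_itv/= ltNge x0.
- by rewrite /= in_itv/= [(1 < y)%R]ltNge y1 andbF.
rewrite !eval_subcurve ?x0 ?y1 ?(le_trans _ y1) ?(le_trans x0) ?(ltW xy)//.
have Tx0 := T_ge0 x0; have Ty1 := T_le1 y1.
have Txy : (T x < T y)%R by rewrite T_lt.
apply: le_trans (nu_speed.1.2 (T x) (T y) Tx0 Txy Ty1).
apply: le_measure; rewrite ?inE//.
  by apply: measurableI => //; apply: mpre.
by move=> z [/= + _]; rewrite !in_itv/= -(T_lt x) -(T_lt _ y) T'K.
Qed.

(** The alternative at each endpoint serves two uses: for the maximality of [nus] the set [A] avoids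
    the endpoints, while an absolutely continuous measure does not charge them. *)
Let J_full (nu' : {measure set (measurableTypeR R) -> \bar R})
    (A : set (measurableTypeR R)) :
  nu' (~` [set` `[0%R, 1%R]]) = 0 -> measurable A ->
  nu' [set (0%R : R)] = 0 \/ ~ A 0%R -> nu' [set (1%R : R)] = 0 \/ ~ A 1%R ->
  nu' A <= nu' (A `&` J).
Proof.
move=> out mA A0 A1.
pose Z : set (measurableTypeR R) :=
  (~` [set` `[0%R, 1%R]] `|` ((A `&` [set 0%R]) `|` (A `&` [set 1%R]))).
have m1 (x : R) : measurable ([set x] : set (measurableTypeR R)).
  exact: measurable_set1.
have mout : measurable (~` [set` `[0%R, 1%R]] : set (measurableTypeR R)).
  by apply: measurableC; exact: measurable_itv.
have null x : nu' [set x] = 0 \/ ~ A x -> nu' (A `&` [set x]) = 0.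
  case=> [nx|nAx].
    apply/eqP; rewrite -measure_le0 -nx le_measure ?inE//.
    exact: measurableI.
  rewrite (_ : _ `&` _ = set0) ?measure0//; apply/seteqP; split => // y [Ay /= yx].
  by apply: nAx; rewrite -yx.
have mZ : measurable Z.
  by apply: measurableU => //; apply: measurableU; exact: measurableI.
have Z0 : nu' Z = 0.
  apply: measure_negligible => //; apply: negligibleU.
    by exists (~` [set` `[0%R, 1%R]]); split => //; exact: out.
  by apply: negligibleU; apply/negligibleP => //;
    do ?[exact: measurableI]; exact: null.
have mAJ : measurable (A `&` J) by exact: measurableI.
apply: (@le_trans _ _ (nu' ((A `&` J) `|` Z))).
  apply: le_measure; rewrite ?inE//; first exact: measurableU.
  move=> x Ax; have [x01|x01] := pselect (`[0%R, 1%R]%classic x); last first.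
    by right; left.
  move: x01; rewrite /= in_itv/= => /andP[].
  rewrite le_eqVlt => /predU1P[x0 _|x0]; first by right; right; left; split.
  rewrite le_eqVlt => /predU1P[x1|x1]; first by right; right; right; split.
  by left; split => //; rewrite /J/= in_itv/= x0.
by rewrite (le_trans (measureU2 _ mAJ mZ))// [X in _ + X]Z0 adde0.
Qed.

(** A competitor [nu'] for the restricted curve, transported by [T] to [(s, t)], is a competitor for
    [c], hence lies below [nu]; transporting back gives [nu' <= nus]. *)
Lemma subcurve_speed_measure : speed_measure (subcurve c) nus.
Proof.
split; first exact: subcurve_restricted_speed.
move=> nu' [nu'out nu'le] A mA.
(* If [A] contains an endpoint, its atom gives [nus A = +oo]. *)
have [A0|A0] := pselect (A 0%R).
  by rewrite nusE infinite_atom_in// addye ?addey ?leey// gt_eqF// (lt_le_trans ltNy0).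
have [A1|A1] := pselect (A 1%R).
  by rewrite nusE (infinite_atom_in A1) !addey ?leey// gt_eqF// (lt_le_trans ltNy0).
rewrite atoms0//; apply: (le_trans (J_full nu'out mA _ _)); [by right|by right|].
pose nu'' := image_measure (mrestr nu' mJ) mT.
have nu''E B : nu'' B = nu' (T @^-1` B `&` J) by [].
have rnu'' : restricted_speed c nu''.
  split.
    rewrite nu''E (_ : _ `&` _ = set0) ?measure0//; apply/seteqP; split => // x.
    rewrite /J/= !in_itv/= => -[nx /andP[x0 x1]]; apply: nx.
    by rewrite T_ge0 ?T_le1 ?ltW.
  move=> x y x0 xy y1; rewrite nu''E.
  (* The interval [(x, y)] may stick out of [[s, t]]: its preimage is clipped to [[0, 1]], and
     monotonicity of the time separation along the curve absorbs the loss. *)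
  pose al : R := Num.max 0%R (T' x); pose be : R := Num.min 1%R (T' y).
  have sub : T @^-1` [set` `]x, y[] `&` J `<=` [set` `]al, be[].
    move=> z; rewrite /J/= !in_itv/= => -[/andP[xz zy] /andP[z0 z1]].
    by rewrite gt_max lt_min z0 z1/= -(T_lt _ z) -(T_lt z) !T'K xz zy.
  have [ab|ab] := ltP al be; last first.
    rewrite (_ : _ `&` _ = set0) ?measure0; last first.
      apply/seteqP; split => // z /sub; rewrite /= in_itv/= => /andP[az zb].
      by have := lt_trans az zb; rewrite ltNge ab.
    by apply: causal_le_eval => //; exact: ltW.
  have al0 : (0 <= al)%R by rewrite le_max lexx.
  have be1 : (be <= 1)%R by rewrite ge_min lexx.
  apply: (@le_trans _ _ (nu' [set` `]al, be[])).
    apply: le_measure; rewrite ?inE//.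
    by apply: measurableI => //; exact: mpre.
  apply: (le_trans (nu'le al be al0 ab be1)).
  rewrite !eval_subcurve; last 2 first.
  - by rewrite be1 (le_trans al0)// ltW.
  - by rewrite al0 (le_trans _ be1)// ltW.
  have xal : (x <= T al)%R by rewrite -[leLHS]T'K T_le le_max lexx orbT.
  have bey : (T be <= y)%R by rewrite -[leRHS]T'K T_le ge_min lexx orbT.
  have Tab : (T al <= T be)%R by rewrite T_le ltW.
  apply: causal_sep_mono; apply: causal_le_eval => //.
  - exact: le_trans Tab (le_trans bey y1).
  - exact: le_trans xal.
  - exact: le_trans bey y1.
  - exact: le_trans x0 (le_trans xal Tab).
have mB : measurable (T' @^-1` A `&` I) by apply: measurableI => //; exact: mpre.
apply: le_trans (nu_speed.2 nu'' rnu'' _ mB).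
rewrite nu''E; apply: le_measure; rewrite ?inE.
- exact: measurableI.
- by apply: measurableI => //; exact: mpre.
- by move=> x [Ax Jx]; split => //; rewrite /= TI TK.
Qed.

Let nuas := image_measure (mrestr nua mI) mT'.

(** Affine maps preserve Lebesgue null sets, so absolutely continuous competitors can be transported
    both ways. They do not charge the endpoints, so the infinite atoms of [nus] add nothing to the
    absolutely continuous part. *)
Lemma subcurve_ac_part : ac_part nus nuas.
Proof.
have [nua_dom nua_le nua_max] := nua_ac.
have a'0 : (0 < a^-1)%R by rewrite invr_gt0.
split.
- apply/null_content_dominatesP => A mA A0.
  apply/eqP; rewrite -measure_le0 /=.
  have <- : nua (T' @^-1` A) = 0.
    move/null_content_dominatesP : nua_dom; apply; first exact: mpre.
    have := lebesgue_measure_affine (- s / a)%R a'0 mA.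
    by rewrite A0 => /esym/eqP; rewrite mule_eq0 gt_eqF//= => /eqP.
  apply: le_measure; rewrite ?inE; last exact: subIsetl.
    by apply: measurableI => //; exact: mpre.
  exact: mpre.
- move=> A mA; rewrite nusE.
  apply: (@le_trans _ _ (nu (T' @^-1` A `&` I))).
    by apply: nua_le; apply: measurableI => //; exact: mpre.
  by rewrite leeDl// adde_ge0.
- move=> la la_dom la_le A mA.
  have la_point x : la [set x] = 0.
    move/null_content_dominatesP : la_dom; apply; first exact: measurable_set1.
    exact: lebesgue_measure_set1.
  have la_out : la (~` [set` `[0%R, 1%R]]) = 0.
    apply/eqP; rewrite -measure_le0 -(subcurve_restricted_speed.1) la_le//.
    by apply: measurableC; exact: measurable_itv.
  apply: (le_trans (J_full la_out mA _ _)); [by left|by left|].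
  pose la'' := image_measure (mrestr la mJ) mT.
  have la''E B : la'' B = la (T @^-1` B `&` J) by [].
  have la''_dom : la'' `<< @lebesgue_measure R.
    apply/null_content_dominatesP => B mB B0.
    apply/eqP; rewrite -measure_le0.
    change (la (T @^-1` B `&` J) <= 0).
    have <- : la (T @^-1` B) = 0.
      move/null_content_dominatesP : la_dom; apply; first exact: mpre.
      have := lebesgue_measure_affine s a0 mB.
      by rewrite B0 => /esym/eqP; rewrite mule_eq0 gt_eqF//= => /eqP.
    apply: le_measure; rewrite ?inE; last exact: subIsetl.
      by apply: measurableI => //; exact: mpre.
    exact: mpre.
  have la''_le B : measurable B -> la'' B <= nu B.
    move=> mB; rewrite la''E.
    have mTB : measurable (T @^-1` B `&` J) by apply: measurableI => //; exact: mpre.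
    apply: (le_trans (la_le _ mTB)); rewrite atoms0; last 2 first.
    - by rewrite /J => -[_ /=]; rewrite in_itv/= ltxx.
    - by rewrite /J => -[_ /=]; rewrite in_itv/= ltxx andbF.
    apply: le_measure; rewrite ?inE//.
      by apply: measurableI => //; exact: mpre.
    by move=> x [[/=]]; rewrite T'K.
  have mB : measurable (T' @^-1` A `&` I) by apply: measurableI => //; exact: mpre.
  apply: le_trans (nua_max la'' la''_dom la''_le _ mB).
  rewrite la''E; apply: le_measure; rewrite ?inE.
  + exact: measurableI.
  + by apply: measurableI => //; exact: mpre.
  + by move=> x [Ax Jx]; split => //; rewrite /= TI TK.
Qed.

Let vs : R -> \bar R := (fun x => a%:E * v (T x)) \_ J.

Lemma subcurve_density : Defs.lebesgue_density nuas vs.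
Proof.
have [mv v0 nuaE] := v_density.
have mvT : measurable_fun setT (fun x : measurableTypeR R => a%:E * v (T x)).
  by apply: measurable_funeM; exact: (measurableT_comp mv mT).
split.
- by apply/(measurable_restrictT _ _).1 => //; exact: measurable_funTS.
- by move=> x; rewrite /vs patchE; case: ifP => // _; rewrite mule_ge0// lee_fin ltW.
move=> A mA.
have mB : measurable (T' @^-1` A `&` I) by apply: measurableI => //; exact: mpre.
rewrite [LHS](nuaE _ mB) (ge0_integral_affine s a0)//; last exact: measurable_funTS.
rewrite -integral_mkcondr -ge0_integralZl//; last 3 first.
- exact: mpre.
- by apply: measurable_funTS; exact: (measurableT_comp mv mT).
- by rewrite lee_fin ltW.
congr integral; apply/seteqP; split => x /=.
  by rewrite -/(T x) TK TI.
by rewrite -/(T x) TK TI.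
Qed.

Lemma subcurve_is_causal_speed : is_causal_speed (subcurve c) vs.
Proof.
exists nus, nuas; split.
- exact: subcurve_speed_measure.
- exact: subcurve_ac_part.
- exact: subcurve_density.
Qed.

End transport.

End restriction.
End speed.

(** * Weighted length of a restriction and measurability of the restriction map *)

Section restriction.
Context {R : realType} {M : ptopologicalType} (l : time_separation R M)
  (d : M -> M -> R).
Hypothesis dM : metrizes d.
Local Notation mu := (@lebesgue_measure R).
Implicit Types c : LCC l.

Definition weighted_length (G : borel M -> \bar R) c : \bar R :=
  \int[mu]_(t in `[0%R, 1%R]) (G (eval t c) * causal_speed c t).

Lemma measurable_weighted_speed (G : borel M -> \bar R) c :
  measurable_fun setT G ->
  measurable_fun setT
    ((fun t => G (eval t c) * causal_speed c t) : measurableTypeR R -> \bar R).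
Proof.
move=> mG; apply: emeasurable_funM; last exact: measurable_causal_speed.
exact: (measurableT_comp mG (measurable_curve dM c)).
Qed.

Lemma weighted_speed_ge0 (G : borel M -> \bar R) c t :
  (forall x, 0 <= G x) -> 0 <= G (eval t c) * causal_speed c t.
Proof. by move=> G0; rewrite mule_ge0// causal_speed_ge0. Qed.

Variables (s t : R).
Hypotheses (s0 : (0 <= s)%R) (st : (s < t)%R) (t1 : (t <= 1)%R).
Local Notation subcurve := (subcurve s0 st t1).

Let ts0 : (0 < t - s)%R. Proof. by rewrite subr_gt0. Qed.

Let affine_gt x : (s < (t - s) * x + s)%R = (0 < x)%R.
Proof. by rewrite ltrDr pmulr_rgt0. Qed.

Let affine_ge x : (s <= (t - s) * x + s)%R = (0 <= x)%R.
Proof. by rewrite lerDr pmulr_rge0. Qed.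

Let affine_lt x : ((t - s) * x + s < t)%R = (x < 1)%R.
Proof. by rewrite -ltrBrDr gtr_pMr. Qed.

Let affine_le x : ((t - s) * x + s <= t)%R = (x <= 1)%R.
Proof. by rewrite -lerBrDr ger_pMr. Qed.

(** The factor [t - s] gained by the speed cancels the Jacobian of the change of variables. The
    existence of a speed for [c] provides the measures to be transported. *)
Lemma weighted_length_subcurve (G : borel M -> \bar R) c :
  (exists v, is_causal_speed c v) ->
  measurable_fun setT G -> (forall x, 0 <= G x) ->
  weighted_length G (subcurve c) =
  \int[mu]_(x in `[s, t]) (G (eval x c) * causal_speed c x).
Proof.
move=> [v cv] mG G0.
pose w := causal_speed c.
have [nu [nua [nu_sp nua_ac w_d]]] : is_causal_speed c w := causal_speedP cv.
have := subcurve_is_causal_speed s0 st t1 nu_sp nua_ac w_d.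
set vs := _ \_ _ => cvs.
have ae_vs := causal_speed_unique (causal_speedP cvs) cvs.
have mvs : measurable_fun setT vs by case: cvs => [? [? [_ _ []]]].
have vs0 r : 0 <= vs r by case: cvs => [? [? [_ _ []]]].
have mg := measurable_weighted_speed c mG.
have g0 x : 0 <= G (eval x c) * w x by exact: weighted_speed_ge0.
(* The chosen speed of the restriction agrees almost everywhere with the explicit density [vs]. *)
transitivity (\int[mu]_(r in `[0%R, 1%R]) (G (eval r (subcurve c)) * vs r)).
  apply: ge0_ae_eq_integral => //.
  - by apply: measurable_funTS; exact: measurable_weighted_speed.
  - apply: measurable_funTS; apply: emeasurable_funM => //.
    exact: (measurableT_comp mG (measurable_curve dM (subcurve c))).
  - by move=> r _; exact: weighted_speed_ge0.
  - by move=> r _; rewrite mule_ge0.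
  - apply: negligibleS ae_vs => r /= /not_implyP[_ nr] vr; apply: nr.
    by rewrite vr.
transitivity (\int[mu]_(r in `[0%R, 1%R] `&` `]0%R, 1%R[)
    ((t - s)%:E * (G (eval ((t - s) * r + s)%R c) * w ((t - s) * r + s)%R))).
  rewrite integral_mkcondr; apply: eq_integral => r.
  rewrite inE => r01; rewrite /vs !patchE; case: ifP => _; last exact: mule0.
  rewrite eval_subcurve; first exact: muleCA.
  by move: r01; rewrite /= in_itv.
rewrite (_ : _ `&` _ =
    (fun r => (t - s) * r + s)%R @^-1` [set` `]s, t[]); last first.
  apply/seteqP; split => r /=; rewrite !in_itv/= affine_gt affine_lt.
    by case.
  by move=> /andP[r0 r1]; rewrite r0 r1 !ltW.
have mT : measurable_fun setT
    ((fun r => (t - s) * r + s)%R : measurableTypeR R -> measurableTypeR R).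
  by apply: measurable_funD => //; exact: measurable_funM.
have mpre : measurable ((fun r => (t - s) * r + s)%R @^-1` [set` `]s, t[] :
    set (measurableTypeR R)).
  by rewrite -[X in measurable X]setTI; exact: mT.
rewrite ge0_integralZl//; last 2 first.
- by apply: measurable_funTS; exact: (measurableT_comp mg mT).
- by rewrite lee_fin ltW.
rewrite -(@ge0_integral_affine _ _ s ts0 _ (fun x => G (eval x c) * w x))//.
  by apply/esym/integral_itv_bndoo; exact: measurable_funTS.
exact: measurable_funTS.
Qed.

(** The initial point of the restriction is the value at time [s], which the integral distance does
    not control; hence the separate first term. *)
Lemma LCC_dist_subcurve c c' :
  LCC_dist d (subcurve c) (subcurve c') <=
  (d (eval s c) (eval s c'))%:E + ((t - s)^-1)%:E * LCC_dist d c c'.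
Proof.
have E0 c1 : eval 0 (subcurve c1) = eval s c1.
  by rewrite eval_subcurve ?lexx ?ler01// mulr0 add0r.
rewrite /LCC_dist !E0 leeD2l// -/(LCC_dist d c c').
pose g x := (d (eval x c) (eval x c'))%:E.
have g0 x : 0 <= g x by rewrite lee_fin metrizes_ge0.
have mg := measurable_EFin_dist_curve dM c c' (D := setT).
have -> : \int[mu]_(r in `[0%R, 1%R])
    (d (eval r (subcurve c)) (eval r (subcurve c')))%:E =
    \int[mu]_(r in (fun r => (t - s) * r + s)%R @^-1` [set` `[s, t]])
      g ((t - s) * r + s)%R.
  rewrite (_ : _ @^-1` _ = [set` `[0%R, 1%R]]).
    apply: eq_integral => r; rewrite inE => r01.
    have {}r01 : (0 <= r <= 1)%R by move: r01; rewrite /= in_itv.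
    by rewrite !(eval_subcurve s0 st t1 _ r01).
  by apply/seteqP; split => r /=; rewrite !in_itv/= affine_ge affine_le.
rewrite -[leLHS]mul1e -[X in X%:E * _](@mulVf _ (t - s)%R) ?gt_eqF//.
rewrite EFinM -muleA -ge0_integral_affine//; last exact: measurable_funTS.
rewrite lee_pmul2l//; last by rewrite lte_fin invr_gt0.
apply: dist_le_LCC_dist => // r; rewrite /= !in_itv/= => /andP[sr rt].
by rewrite (le_trans s0 sr) (le_trans rt t1).
Qed.

(** Restriction becomes continuous once the value at time [s] is confined to a small ball. So the
    preimage of an open set is a countable union, over balls around a dense sequence, of the
    measurable condition that [eval s] lies in the ball and an open condition [V]. *)
Lemma measurable_subcurve : separable M ->
  measurable_fun setT (subcurve : borel_LCC l d -> borel_LCC l d).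
Proof.
move=> /separable_dense_seq[u uD].
apply: (@measurability _ _ (borel_LCC l d) (borel_LCC l d) setT subcurve
  (@LCC_open R M l d) erefl).
move=> _ [U Uo <-]; rewrite setTI.
pose B n k : set (borel M) := [set y | (d (u n) y < k.+1%:R^-1)%R].
pose V n k : set (borel_LCC l d) := [set c : LCC l | exists2 e : R, (0 < e)%R &
  forall c', LCC_dist d c c' < e%:E -> B n k (eval s c') -> U (subcurve c')].
have -> : (subcurve @^-1` U : set (borel_LCC l d)) =
    \bigcup_n \bigcup_k ((eval s @^-1` B n k) `&` V n k).
  apply/seteqP; split => c /=; last first.
    move=> [n _ [k _ [Bc [e e0 Vc]]]]; apply: Vc => //.
    by rewrite LCC_dist_refl.
  move=> /Uo[e e0 Ue].
  have e40 : (0 < e / 4)%R by rewrite divr_gt0.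
  have [k _ /(_ k (leqnn k))/= ke] := near_infty_natSinv_lt (PosNum e40).
  have [|n /= cn] := uD _ (dist_ball_open dM (eval s c) (k.+1%:R^-1)%R).
    by exists (eval s c); rewrite /= dist_refl// invr_gt0.
  exists n => //; exists k => //; split; first by rewrite /B/= (metrizes_sym dM).
  (* Half of [e] bounds the distance at time [s], through two radii below [e / 4]; the other half
     bounds the integral term, the factor [t - s] offsetting the rescaling. *)
  exists (e / 2 * (t - s))%R; first by rewrite mulr_gt0// divr_gt0.
  move=> c' cc' Bc'; apply: Ue => /=.
  apply: (le_lt_trans (LCC_dist_subcurve c c')).
  have Dfin : LCC_dist d c c' \is a fin_num.
    rewrite ge0_fin_numE; first exact: lt_trans cc' (ltry _).
    by apply: le_trans (dist0_le_LCC_dist dM c c'); rewrite lee_fin metrizes_ge0.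
  rewrite [e]splitr EFinD; apply: lte_leD; first by rewrite fin_numM.
    rewrite lte_fin (le_lt_trans (metrizes_triangle dM _ (u n) _))//.
    rewrite (_ : e / 2 = e / 4 + e / 4)%R; last by field.
    by rewrite ltrD ?(lt_trans _ ke).
  rewrite -(@lee_pmul2l _ (t - s)%:E) ?lte_fin// muleA -!EFinM divff ?gt_eqF//.
  by rewrite mul1e mulrC ltW.
apply: bigcupT_measurable => n; apply: bigcupT_measurable => k.
apply: measurableI.
  have s01 : (0 <= s <= 1)%R by rewrite s0 (le_trans (ltW st)).
  have := measurable_eval dM s01; rewrite -[X in measurable X]setTI; apply => //.
  by apply: sub_sigma_algebra; exact: dist_ball_open.
apply: sub_sigma_algebra => c [e e0 Vc].
have e20 : (0 < e / 2)%R by rewrite divr_gt0.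
exists (e / 2)%R => // c' /= cc'; exists (e / 2)%R => // c'' cc''; apply: Vc.
apply: (le_lt_trans (LCC_dist_triangle dM c c' c'')).
by rewrite [e]splitr EFinD lteD.
Qed.

End restriction.

(** * Weak subslopes *)

Definition image_probability d d' (T : measurableType d) (T' : measurableType d')
    (R : realType) (P : probability T R) (f : T -> T')
    (mf : measurable_fun setT f) : probability T' R :=
  distribution P (mfun_Sub (mem_set mf)).

Lemma image_probabilityE d d' (T : measurableType d) (T' : measurableType d')
    (R : realType) (P : probability T R) (f : T -> T')
    (mf : measurable_fun setT f) A : image_probability P mf A = P (f @^-1` A).
Proof. by []. Qed.

(** For [v = +oo] the convention on 0 times infinity matters: either all [a n] vanish and both sides
    are 0, or some [a n > 0] makes both infinite. *)
Lemma ereal_sup_mulr (R : realType) (a : nat -> \bar R) (v : \bar R) :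
  (forall n, 0 <= a n) -> 0 <= v ->
  ereal_sup (range a) * v = ereal_sup (range (fun n => a n * v)).
Proof.
move=> a0 v0; have sup0 : 0 <= ereal_sup (range a).
  by apply: (le_trans (a0 0%N)); apply: ereal_sup_ubound; exists 0%N.
case: v v0 => [r| |]// v0.
  have range0 : range a != set0 by apply/set0P; exists (a 0%N), 0%N.
  rewrite muleC -ereal_supZl//; congr ereal_sup; apply/seteqP; split.
    by move=> _ [_ [n _ <-] <-]; exists n => //; rewrite muleC.
  by move=> _ [n _ <-]; exists (a n); [exists n|rewrite muleC].
have [a00|/existsNP[n an]] := pselect (forall n, a n = 0).
  have -> : a = cst 0.
    by rewrite funeqE.
  have r0 : range (cst 0 : nat -> \bar R) = [set 0].
    by apply/seteqP; split => [_ [n _ <-]//|_ ->]; exists 0%N.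
  rewrite r0 ereal_sup1 mul0e -[LHS]ereal_sup1 -r0.
  by congr (ereal_sup (range _)); rewrite funeqE => n; rewrite mul0e.
have an0 : 0 < a n by rewrite lt0e a0 andbT; exact/eqP.
transitivity (+oo : \bar R).
  rewrite gt0_muley// (lt_le_trans an0)//.
  by apply: ereal_sup_ubound; exists n.
apply/esym/eqP; rewrite -leye_eq; apply: ereal_sup_ubound; exists n => //.
by rewrite gt0_muley.
Qed.

Section subslopes.
Context {R : realType} {M : ptopologicalType} (l : time_separation R M)
  (m : {measure set (borel M) -> \bar R}).
Hypothesis mms : metric_measure_spacetime l m.
Variable d : M -> M -> R.
Hypotheses (dM : metrizes d) (f : M -> \bar R) (f_causal : causal_function l m f).
Local Notation mu := (@lebesgue_measure R).
Local Notation curves := (borel_LCC l d).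
Implicit Types (c : LCC l) (pi : probability curves R) (G : borel M -> \bar R).

Lemma test_plan_null pi t (N : set (borel M)) : test_plan m pi ->
  (0 <= t <= 1)%R -> measurable N -> m N = 0 -> pi (eval t @^-1` N) = 0.
Proof.
move=> [C C0 piC] t01 mN N0; apply/eqP; rewrite -measure_le0.
by apply: le_trans (piC t t01 N mN) _; rewrite N0 mule0.
Qed.

Lemma test_plan_subcurve (s t : R) (s0 : (0 <= s)%R) (st : (s < t)%R)
    (t1 : (t <= 1)%R) (mr : measurable_fun setT
      (subcurve s0 st t1 : curves -> curves)) pi :
  test_plan m pi -> test_plan m (image_probability pi mr).
Proof.
move=> [C C0 piC]; exists C => // r r01 A mA.
rewrite /pushforward image_probabilityE.
have Tr01 : (0 <= (t - s) * r + s <= 1)%R.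
  case/andP: r01 => r0 r1; have ts : (0 <= t - s)%R by rewrite subr_ge0 ltW.
  rewrite addr_ge0 ?mulr_ge0//=; apply: (le_trans _ t1).
  by rewrite -lerBrDr ler_piMr.
apply: le_trans (piC _ Tr01 A mA); rewrite /pushforward.
rewrite (_ : _ @^-1` _ = eval ((t - s) * r + s)%R @^-1` A)//.
rewrite predeqE => c.
have E := eval_subcurve s0 st t1 c r01.
by rewrite /preimage /mkset E.
Qed.

Lemma causal_increment_ge0 c (s t : R) : (0 <= s)%R -> (s <= t)%R -> (t <= 1)%R ->
  0 <= subel (f (eval t c)) (f (eval s c)).
Proof.
move=> s0 st t1; apply: subel_ge0; apply: (causal_monotone f_causal).
exact: causal_le_eval.
Qed.

(** A single Borel [F] serves all test plans: [f] agrees with a Borel function off an [m]-null set,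
    and the marginal bounds of a test plan make almost every curve avoid that set at both end
    times. *)
Lemma measurable_increment : exists2 F : curves -> \bar R,
  measurable_fun setT F /\ (forall c, 0 <= F c) &
  forall pi, test_plan m pi ->
    {ae pi, forall c, subel (f (eval 1 c)) (f (eval 0 c)) = F c}.
Proof.
have [g mg [N [mN N0 fgN]]] :=
  completion_measurable_representative (causal_measurable f_causal).
pose z (c : curves) : \bar R := g (eval 1 c) - g (eval 0 c).
have me t : (0 <= t <= 1)%R -> measurable_fun setT (fun c : curves => g (eval t c)).
  by move=> t01; exact: (measurableT_comp mg (measurable_eval dM t01)).
have mz : measurable_fun setT z.
  by apply: emeasurable_funB; apply: me; rewrite lexx ler01.
(* The difference [z] evaluates both indeterminate forms to [-oo], whereas [subel] gives [+oo]. True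
   increments being nonnegative, a negative [z] signals these cases almost surely. *)
exists (fun c => if z c < 0 then +oo else z c).
  split; last by move=> c; case: ltP; rewrite ?leey.
  apply: measurable_fun_ifT => //; apply: (measurable_fun_bool true).
  rewrite (_ : _ @^-1` _ = [set x | z x < 0]); last by [].
  exact: emeasurable_fun_infty_o.
move=> pi tp.
have e0 : (0 <= (0 : R) <= 1)%R by rewrite lexx ler01.
have e1 : (0 <= (1 : R) <= 1)%R by rewrite lexx ler01.
have null t : (0 <= t <= 1)%R -> pi.-negligible (eval t @^-1` N).
  move=> t01; exists (eval t @^-1` N); split => //.
    by rewrite -[X in measurable X]setTI; exact: measurable_eval.
  exact: test_plan_null.
apply: negligibleS (negligibleU (null _ e1) (null _ e0)) => c /= nF.
apply: contrapT => /not_orP[N1 N0']; apply: nF.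
have fg x : ~ N x -> f x = g x by move=> Nx; apply: contrapT => /fgN.
have := causal_increment_ge0 c (lexx 0%R) ler01 (lexx 1%R).
rewrite /z (fg _ N1) (fg _ N0').
case: (g (eval 1 c)) => [x| |]; case: (g (eval 0 c)) => [y| |] //=.
- by rewrite lee_fin -EFinB lte_fin => /le_gtF ->.
- by rewrite addeNy ltNy0.
- by rewrite addNye ltNy0.
Qed.

(** Localization: any probability bounded by a multiple of a test plan is again a test plan, so the
    integral inequality holds for all of them and [ae_le_of_integrals] applies. *)
Lemma weak_subslope_ae G pi : weak_subslope l m d f G -> test_plan m pi ->
  {ae pi, forall c,
    weighted_length G c <= subel (f (eval 1 c)) (f (eval 0 c))}.
Proof.
move=> [mG G0 GE] tp; have [F [mF F0] Fae] := measurable_increment.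
have : {ae pi, forall c, weighted_length G c <= F c}.
  apply: ae_le_of_integrals => // Q [C C0 QC].
  have tQ : test_plan m Q.
    have [C' C'0 piC'] := tp; exists (C * C')%R; first exact: mulr_gt0.
    move=> t t01 A mA; rewrite /pushforward.
    have mtA : measurable (eval t @^-1` A : set curves).
      by rewrite -[X in measurable X]setTI; exact: (measurable_eval dM t01).
    rewrite (le_trans (QC _ mtA))// EFinM -muleA lee_pmul2l ?lte_fin//.
    exact: piC'.
  apply: (le_trans (GE Q tQ)).
  rewrite (@ge0_ae_measurable_integral _ _ _ _ _ F)//; last exact: Fae.
  by move=> c; exact: causal_increment_ge0.
move=> H; apply: negligibleS (negligibleU H (Fae pi tp)) => c /= nle.
by apply/not_andP => -[GF FE]; apply: nle; rewrite FE.
Qed.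

(** The weighted length need not be measurable in the curve; its upper integral is bounded through
    the measurable majorant equal to [F] off a null set and to [+oo] on it. *)
Lemma ae_weak_subslope G : measurable_fun setT G -> (forall x, 0 <= G x) ->
  (forall pi, test_plan m pi -> {ae pi, forall c,
    weighted_length G c <= subel (f (eval 1 c)) (f (eval 0 c))}) ->
  weak_subslope l m d f G.
Proof.
move=> mG G0 Gae; split => // pi tp.
have [F [mF F0] Fae] := measurable_increment.
have inc0 c : 0 <= subel (f (eval 1 c)) (f (eval 0 c)).
  exact: causal_increment_ge0.
rewrite (@ge0_ae_measurable_integral _ _ _ _ _ F)//; last exact: Fae.
have [N [mN N0 GFN]] : {ae pi, forall c, weighted_length G c <= F c}.
  apply: negligibleS (negligibleU (Gae pi tp) (Fae pi tp)) => c /= nle.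
  by apply/not_andP => -[GF FE]; apply: nle; rewrite -FE.
pose g c := if c \in N then +oo else F c.
have mg : measurable_fun setT (g : curves -> \bar R).
  apply: measurable_fun_ifT => //.
  by apply: (measurable_fun_bool true); rewrite setTI preimage_mem_true.
have -> : \int[pi]_x F x = \int[pi]_x g x.
  apply: ge0_ae_eq_integral => //.
    by move=> c _; rewrite /g; case: ifP => //; rewrite leey.
  exists N; split => // c /= nFg; apply: contrapT => Nc; apply: nFg => _.
  by rewrite /g memNset.
apply: ereal_inf_lbound; exists g => //; split => // c.
rewrite /g; case: ifPn => [_|]; first exact: leey.
rewrite notin_setE => Nc; apply: contrapT => nle; apply: Nc.
exact: GFN.
Qed.

Lemma weak_subslope_dominates G pi : weak_subslope l m d f G -> test_plan m pi ->
  {ae pi, forall c, dominates_on_rational_itv (fun t => f (eval t c))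
    (fun t => G (eval t c) * causal_speed c t)}.
Proof.
move=> wG tp; have [mG G0 _] := wG.
have sepM := (mms_polish mms).1.
pose bad (s t : rat) : set curves := [set c | [/\ (0 <= s)%R, (s < t)%R, (t <= 1)%R &
  ~ (\int[mu]_(x in `[ratr s, ratr t]) (G (eval x c) * causal_speed c x)
     <= subel (f (eval (ratr t) c)) (f (eval (ratr s) c)))]].
have null s t : pi.-negligible (bad s t).
  have [[s0 st t1]|nst] := pselect [/\ (0 <= s)%R, (s < t)%R & (t <= 1)%R]; last first.
    apply: negligibleS (negligible_set0 _) => c -[s0 st t1 _].
    by apply: nst.
  have s0R : (0 <= ratr s :> R)%R by rewrite ler0q.
  have stR : (ratr s < ratr t :> R)%R by rewrite ltr_rat.
  have t1R : (ratr t <= 1 :> R)%R by rewrite -(@rmorph1 _ _ (@ratr R)) ler_rat.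
  have mr := measurable_subcurve dM s0R stR t1R sepM (l := l).
  have [N [mN N0 HN]] := weak_subslope_ae wG (test_plan_subcurve mr tp).
  exists (subcurve s0R stR t1R @^-1` N); split => //.
    by rewrite -[X in measurable X]setTI; exact: (mr).
  move=> c [_ _ _ nle]; apply: HN => le; apply: nle.
  (* A curve without a speed has [causal_speed] 0 by default, so its integral vanishes and the
     increment is nonnegative. *)
  have [sp|nsp] := pselect (exists v, is_causal_speed c v).
    move: le; rewrite /mkset (weighted_length_subcurve dM)//.
    rewrite !eval_subcurve ?lexx ?ler01//.
    by rewrite mulr0 add0r mulr1 subrK.
  rewrite (causal_speed_none nsp) integral0_eq; last by move=> x _; rewrite mule0.
  by apply: causal_increment_ge0 => //; exact: ltW.
pose N k := if (unpickle k : option (rat * rat)) is Some (s, t) then bad s t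
  else set0.
have : pi.-negligible (\bigcup_k N k).
  apply: negligible_bigcup => k; rewrite /N; case: unpickle => [[s t]|].
    exact: null.
  exact: negligible_set0.
apply: negligibleS => c /=.
move=> /existsNP[s /existsNP[t /not_implyP[s0 /not_implyP[st /not_implyP[t1 H]]]]].
by exists (pickle (s, t)); [exact: Logic.I|rewrite /N pickleK].
Qed.

Lemma weak_subslope0 : weak_subslope l m d f (cst 0).
Proof.
apply: ae_weak_subslope => // pi tp.
apply: negligibleS (negligible_set0 _) => c /=; apply.
rewrite /weighted_length integral0_eq; last by move=> x _; rewrite mul0e.
exact: causal_increment_ge0.
Qed.

Lemma weak_subslope_max G1 G2 :
  weak_subslope l m d f G1 -> weak_subslope l m d f G2 ->
  weak_subslope l m d f (fun x => maxe (G1 x) (G2 x)).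
Proof.
move=> w1 w2; have [mG1 G10 _] := w1; have [mG2 G20 _] := w2.
apply: ae_weak_subslope; first exact: measurable_maxe.
  by move=> x; rewrite le_max G10.
move=> pi tp.
apply: negligibleS (negligibleU (weak_subslope_dominates w1 tp)
  (weak_subslope_dominates w2 tp)) => c /= nle.
apply/not_andP => -[dom1 dom2]; apply: nle.
(* Multiplication by the nonnegative speed commutes with the maximum, so the two weighted functions
   along the curve can be fed to [dominates_max]. *)
have <- : \int[mu]_(t in `[0%R, 1%R]) maxe (G1 (eval t c) * causal_speed c t)
    (G2 (eval t c) * causal_speed c t) =
    weighted_length (fun x => maxe (G1 x) (G2 x)) c.
  apply: eq_integral => t _; have v0 := causal_speed_ge0 c t.
  case: (leP (G1 (eval t c)) (G2 (eval t c))) => [G12|/ltW G21].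
    by apply/max_idPr; rewrite lee_wpmul2r.
  by apply/max_idPl; rewrite lee_wpmul2r.
apply: (dominates_max (phi := fun t => f (eval t c))) => //.
- move=> x y x0 xy y1; apply: (causal_monotone f_causal).
  exact: causal_le_eval.
- exact: (measurable_weighted_speed dM).
- exact: (measurable_weighted_speed dM).
- by move=> x; exact: weighted_speed_ge0.
- by move=> x; exact: weighted_speed_ge0.
Qed.

Lemma weak_subslope_nondecreasing (u : nat -> borel M -> \bar R) :
  (forall n, weak_subslope l m d f (u n)) ->
  (forall x, nondecreasing_seq (u ^~ x)) ->
  weak_subslope l m d f (fun x => ereal_sup (range (u ^~ x))).
Proof.
move=> wu ndu.
have mu_ n : measurable_fun setT (u n) by have [] := wu n.
have u0 n x : 0 <= u n x by have [] := wu n.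
apply: ae_weak_subslope.
- apply: (eq_measurable_fun (fun x => limn (u ^~ x))).
    by move=> x _; apply/cvg_lim => //; exact: ereal_nondecreasing_cvgn.
  apply: (emeasurable_fun_cvg u) => // x _.
  exact: ereal_nondecreasing_is_cvgn.
- by move=> x; apply: (le_trans (u0 0%N x)); apply: ereal_sup_ubound; exists 0%N.
move=> pi tp.
apply: negligibleS (ae_foralln (fun n => weak_subslope_ae (wu n) tp)) => c /= nle H.
apply: nle; rewrite /weighted_length.
have -> : \int[mu]_(t in `[0%R, 1%R])
    (ereal_sup (range (u ^~ (eval t c))) * causal_speed c t) =
    \int[mu]_(t in `[0%R, 1%R])
      ereal_sup (range (fun n => u n (eval t c) * causal_speed c t)).
  by apply: eq_integral => t _; rewrite ereal_sup_mulr ?causal_speed_ge0.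
apply: integral_ereal_sup_le => //.
- by move=> n; apply: measurable_funTS; exact: (measurable_weighted_speed dM).
- by move=> n t _; exact: weighted_speed_ge0.
- by move=> t _ i j ij; rewrite lee_wpmul2r ?causal_speed_ge0//; exact: ndu.
Qed.

(** The partial maxima [w n] form a nondecreasing sequence of weak subslopes with the same
    supremum. *)
Lemma weak_subslope_sup (u : nat -> borel M -> \bar R) :
  (forall n, weak_subslope l m d f (u n)) ->
  weak_subslope l m d f (fun x => ereal_sup (range (u ^~ x))).
Proof.
move=> wu.
pose w := fix w n x := if n is n'.+1 then maxe (w n' x) (u n'.+1 x) else u 0%N x.
have ww n : weak_subslope l m d f (w n).
  by elim: n => [|n IH]; [exact: wu|exact: (weak_subslope_max IH (wu n.+1))].
have ndw x : nondecreasing_seq (w ^~ x).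
  by apply/nondecreasing_seqP => n; rewrite /= le_max lexx.
rewrite (_ : (fun x => _) = fun x => ereal_sup (range (w ^~ x))).
  exact: weak_subslope_nondecreasing.
rewrite funeqE => x; apply/eqP; rewrite eq_le; apply/andP; split.
  apply: ge_ereal_sup => _ [n _ <-]; apply: (@le_trans _ _ (w n x)).
    by case: n => //= n; rewrite le_max lexx orbT.
  by apply: ereal_sup_ubound; exists n.
apply: ge_ereal_sup => _ [n _ <-]; elim: n => [|n IH] /=.
  by apply: ereal_sup_ubound; exists 0%N.
by rewrite ge_max IH/=; apply: ereal_sup_ubound; exists n.+1.
Qed.

End subslopes.

Theorem theorem3p14 (R : realType) (M : ptopologicalType)
    (l : time_separation R M) (m : {measure set (borel M) -> \bar R})
    (mms : metric_measure_spacetime l m)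
    (d : M -> M -> R) (d_metrizes : metrizes d) (d_bounded : bounded_dist d)
    (f : M -> \bar R) (f_causal : causal_function l m f) :
  (exists G : borel M -> \bar R, maximal_weak_subslope l m d f G) /\
  (forall G1 G2 : borel M -> \bar R,
     maximal_weak_subslope l m d f G1 -> maximal_weak_subslope l m d f G2 ->
     {ae m, forall x, G1 x = G2 x}).
Proof.
split; last first.
  move=> G1 G2 [w1 max1] [w2 max2].
  apply: negligibleS (negligibleU (max1 _ w2) (max2 _ w1)) => x /= nE.
  by apply/not_andP => -[le21 le12]; apply: nE; apply/eqP; rewrite eq_le le21 le12.
have sf : sigma_finite setT m.
  by apply: locally_finite_sigma_finite d_metrizes (mms_polish mms).1 (mms_radon mms).1.
have [G wG maxG] := ess_max_countable_sup (S := weak_subslope l m d f) sf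
  (ex_intro _ _ (weak_subslope0 d_metrizes f_causal))
  (fun G wG => subslope_measurable wG) (weak_subslope_sup mms d_metrizes f_causal).
by exists G.
Qed.
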